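(* Let $(X,\mu,T)$ be a Furstenberg system of a completely multiplicative function $f\colon\mathbb N\to\mathbb U$. Let $\alpha\in\mathrm{Spec}(X,\mu,T)$ and let $r\in\mathbb N$ be such that $f(r)\neq 0$. (i) (Logarithmic averages) If the Furstenberg system is defined using logarithmic averages, then $(\alpha+k)/r\in \mathrm{Spec}(X,\mu,T)$ for some $k\in\{0,\ldots,r-1\}$. (ii) (Cesàro averages) If the Furstenberg system is defined using Cesàro averages, then $(\alpha+k)/r\in\mathrm{Spec}(X,\mu_r,T)$ for some $k\in\{0,\ldots,r-1\}$, where $(X,\mu_r,T)$ is another (possibly different) Furstenberg system of $f$ for Cesàro averages. If $(X,\mu,T)$ is ergodic, then one can take $\mu_r=\mu$.
   Context: $\mathbb N=\{1,2,\ldots\}$, $\mathbb U$ is the closed complex unit disc, $e(t)=e^{2\pi i t}$, $[N]=\{1,\ldots,N\}$. A function $f\colon\mathbb N\to\mathbb U$ is completely multiplicative if $f(mn)=f(m)f(n)$ for all $m,n\in\mathbb N$. For a finite non-empty $A\subset\mathbb N$ and $a\colon A\to\mathbb C$, $\mathbb E_{n\in A}a(n)=\frac1{|A|}\sum_{n\in A}a(n)$ (Cesàro average) and $\mathbb E^{\log}_{n\in A}a(n)=\big(\sum_{n\in A}\frac1n\big)^{-1}\sum_{n\in A}\frac{a(n)}n$ (logarithmic average); these also act on measures. Let $X=\mathbb U^{\mathbb Z}$ with the product topology and let $T\colon X\to X$ be the shift $(Tx)(k)=x(k+1)$. A sequence $a\colon\mathbb N\to\mathbb U$ is extended to $\mathbb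 Z$ arbitrarily (the extension does not matter) and viewed as a point of $X$. If $(N_k)$ is a strictly increasing sequence of positive integers and the weak-star limit $\mu=\lim_{k\to\infty}\mathbb E_{n\in[N_k]}\delta_{T^na}$ exists, then $(X,\mu,T)$ is called the Furstenberg system of $a$ along $(N_k)$ for Cesàro averages. With $\mathbb E^{\log}$ in place of $\mathbb E$ one gets the Furstenberg system of $a$ along $(N_k)$ for logarithmic averages. A Furstenberg system of $a$ is one obtained along some $(N_k)$. The spectrum $\mathrm{Spec}(X,\mu,T)$ is the set of $\alpha\in[0,1)$ for which there is a non-zero $g\in L^2(\mu)$ with $g\circ T=e(\alpha)\,g$. *)

(* Defs.v *)
From HB Require Import structures.
From mathcomp Require Import all_boot all_order all_algebra.
From mathcomp Require Import all_classical all_reals all_analysis.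
From mathcomp Require Import interval_inference.
From mathcomp.real_closed Require Import complex.

Set Implicit Arguments.
Unset Strict Implicit.
Unset Printing Implicit Defensive.

Import Order.TTheory GRing.Theory Num.Theory.
Import numFieldNormedType.Exports.

Local Open Scope classical_set_scope.
Local Open Scope complex_scope.
Local Open Scope ring_scope.

(* The topology of the modulus on R[i], for which the library has no
   canonical instance. *)
HB.instance Definition _ (R : rcfType) := PseudoPointedMetric.copy R[i] R[i]^o.
HB.instance Definition _ (R : rcfType) := GRing.ComAlgebra.copy R[i] R[i]^o.
HB.instance Definition _ (R : rcfType) := Vector.copy R[i] R[i]^o.
HB.instance Definition _ (R : rcfType) := NormedModule.copy R[i] R[i]^o.

Section FurstenbergSystems.
Variable R : realType.

Definition unit_disc : Type := set_type [set z : R[i] | `|z| <= 1].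

HB.instance Definition _ := Topological.on unit_disc.

Lemma unit_disc0_subproof : (0 : R[i]) \in [set z : R[i] | `|z| <= 1].
Proof. by rewrite inE /= normr0 ler01. Qed.

HB.instance Definition _ :=
  isPointed.Build unit_disc (SigSub unit_disc0_subproof).

Definition disc_val (z : unit_disc) : R[i] := val z.

(* Sequences indexed by {1, 2, ...} are functions on nat whose value at 0 is
   never constrained nor used. *)
Definition completely_multiplicative (f : nat -> unit_disc) : Prop :=
  forall m n : nat, (0 < m)%N -> (0 < n)%N ->
    disc_val (f (m * n)%N) = disc_val (f m) * disc_val (f n).

Definition shift_space := {ptws int -> unit_disc}.

HB.instance Definition _ := Pointed.on shift_space.
HB.instance Definition _ := Topological.on shift_space.
HB.instance Definition _ :=
  Measurable.copy shift_space (g_sigma_algebraType (@open shift_space)).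

Definition left_shift (x : shift_space) : shift_space := fun k => x (k + 1).

Definition extends (x : shift_space) (a : nat -> unit_disc) : Prop :=
  forall n : nat, (0 < n)%N -> x n%:Z = a n.

(* The measures averaging the Dirac masses at T^n x over n = 1, ..., N; the
   index of msum starts at 0, hence the successors. *)
Definition cesaro_avg (x : shift_space) (N : nat) :
    {measure set shift_space -> \bar R} :=
  mscale (N%:R^-1)%:nng (msum (fun i => \d_(iter i.+1 left_shift x)) N).

Lemma harmonic_sumV_ge0 (N : nat) :
  0 <= (\sum_(1 <= n < N.+1) n%:R^-1)^-1 :> R.
Proof. by rewrite invr_ge0 sumr_ge0// => i _; rewrite invr_ge0. Qed.

Definition log_avg (x : shift_space) (N : nat) :
    {measure set shift_space -> \bar R} :=
  mscale (NngNum (harmonic_sumV_ge0 N))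
    (msum (fun i => mscale (i.+1%:R^-1)%:nng \d_(iter i.+1 left_shift x)) N).

(* Real test functions suffice: a complex one is tested through its real and
   imaginary parts. *)
Definition weak_star_cvg (nu : nat -> {measure set shift_space -> \bar R})
    (mu : probability shift_space R) : Prop :=
  forall F : shift_space -> R, continuous F ->
    (fun k => \int[nu k]_y F y) @ \oo --> \int[mu]_y F y.

Definition furstenberg_system_along
    (avg : shift_space -> nat -> {measure set shift_space -> \bar R})
    (x : shift_space) (N_ : nat -> nat) (mu : probability shift_space R) :
    Prop :=
  [/\ {homo N_ : j k / (j < k)%N}, forall k, (0 < N_ k)%N
    & weak_star_cvg (fun k => avg x (N_ k)) mu].

Definition furstenberg_system
    (avg : shift_space -> nat -> {measure set shift_space -> \bar R})
    (x : shift_space) (mu : probability shift_space R) : Prop :=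
  exists N_ : nat -> nat, furstenberg_system_along avg x N_ mu.

Definition expi (t : R) : R[i] := cos (2 * pi * t) +i* sin (2 * pi * t).

Definition square_integrable (mu : probability shift_space R)
    (g : shift_space -> R[i]) : Prop :=
  [/\ measurable_fun setT (fun y => complex.Re (g y)),
      measurable_fun setT (fun y => complex.Im (g y))
    & (\int[mu]_y (complex.Re (g y) ^+ 2 + complex.Im (g y) ^+ 2)%:E < +oo)%E].

(* A class in L^2 is represented by one of its members: it is non-zero when
   this member is not almost everywhere zero. *)
Definition spectrum (mu : probability shift_space R) : set R :=
  [set alpha | 0 <= alpha < 1 /\
    exists g : shift_space -> R[i],
      [/\ square_integrable mu g,
          ~ {ae mu, forall y, g y = 0}
        & {ae mu, forall y, g (left_shift y) = expi alpha * g y}]].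

Definition ergodic (mu : probability shift_space R) : Prop :=
  forall A : set shift_space, measurable A -> left_shift @^-1` A = A ->
    mu A = 0%E \/ mu A = 1%E.

End FurstenbergSystems.

(* Main.v *)
From HB Require Import structures.
Require Import Defs.
From mathcomp Require Import all_boot all_order all_algebra.
From mathcomp Require Import all_classical all_reals all_analysis.
From mathcomp.real_closed Require Import complex.
From mathcomp Require Import measurable_realfun.
From mathcomp Require Import ring lra zify.

Set Implicit Arguments.
Unset Strict Implicit.
Unset Printing Implicit Defensive.

Import Order.TTheory GRing.Theory Num.Theory.
Import numFieldNormedType.Exports.

Local Open Scope classical_set_scope.
Local Open Scope complex_scope.
Local Open Scope ring_scope.

(** Let [x] extend the completely multiplicative [f] and let [T] be the shift.
   Reading [T^(r n) x] along the multiples of [r] gives [f r] times [T^n x].  The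
   map [dilate] reads a point along the multiples of [r] and divides by [f r]; it
   intertwines [T^r] with [T], and sends [T^(r n) x] to a point that agrees with
   [T^n x] on all positive positions and more and more negative ones.

   Averages along the multiples of [r] are part of the averages along all
   integers.  So if [mu] is a limit of averages at the scale [N] and [nu] one at
   the scale [r N], then [mu] is at most a constant times the image of [nu] under
   [dilate] ([limit_average_transfer]).  Let [g] be an eigenfunction for [mu] with
   eigenvalue [e(alpha)].  After a restriction to the part of the space where the
   image of [nu] has the same null sets as [mu], the function [g \o dilate] is an
   eigenfunction of [T^r] for [nu] ([spectrum_lift]), and Fourier analysis on the
   cyclic group of order [r] extracts from it an eigenfunction of [T] with
   eigenvalue [e((alpha + k) / r)] ([spectrum_root]).

   It remains to choose the scales.  Logarithmic averages have the same limits at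
   the scales [N] and [N / r], so [nu = mu] is possible.  For Cesaro averages, [nu]
   is a limit along a subsequence of [r N_k], which exists by weak compactness
   ([weak_limit_exists]).  If [mu] is ergodic, take instead a limit [nu] along
   [N_k / r]: it is absolutely continuous with respect to [mu], and an
   eigenfunction of an ergodic system vanishes almost nowhere, so [e(alpha)] is
   also an eigenvalue for [nu] ([ergodic_spectrum]); the transfer then leads from
   [nu] at the scale [N_k / r] to [mu] at the scale [N_k].

   Weak limits are constructed by coding the points of the shift space with
   infinite sequences of bits: frequencies of finite words converge along a
   subsequence, and the image of the uniform law under a quantile map has the
   limiting frequencies.  Regularity of Borel measures turns inequalities between
   integrals of continuous functions into inequalities between measures
   ([integral_domination]). *)

(** * The closed disc and its radial retraction *)
Section ComplexTopology.
Variable R : realType.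
Implicit Types (z : R[i]).

Lemma ler_normRe z : `|complex.Re z| <= complex.Re `|z|.
Proof.
rewrite normc_def /= -sqrtr_sqr ler_sqrt ?lerDl ?sqr_ge0//.
by rewrite addr_ge0 ?sqr_ge0.
Qed.

Lemma ler_normIm z : `|complex.Im z| <= complex.Re `|z|.
Proof.
rewrite normc_def /= -sqrtr_sqr ler_sqrt ?lerDr ?sqr_ge0//.
by rewrite addr_ge0 ?sqr_ge0.
Qed.

Lemma ReB (z w : R[i]) : complex.Re (z - w) = complex.Re z - complex.Re w.
Proof. by case: z w => [a b] [c d]. Qed.

Lemma ImB (z w : R[i]) : complex.Im (z - w) = complex.Im z - complex.Im w.
Proof. by case: z w => [a b] [c d]. Qed.

Lemma Re_continuous : continuous (@complex.Re R).
Proof.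
move=> z; apply/(@cvgrPdist_lt _ R _ _ (nbhs_filter z)) => e e0; near=> w.
rewrite -ReB; apply: le_lt_trans (ler_normRe _) _.
suff : `|z - w| < e%:C by rewrite ltcE => /andP[].
near: w; apply/(@nbhs_ballP _ R[i]); exists e%:C; rewrite /= ?ltcR.
Unshelve. all: by end_near. Qed.

Lemma Im_continuous : continuous (@complex.Im R).
Proof.
move=> z; apply/(@cvgrPdist_lt _ R _ _ (nbhs_filter z)) => e e0; near=> w.
rewrite -ImB; apply: le_lt_trans (ler_normIm _) _.
suff : `|z - w| < e%:C by rewrite ltcE => /andP[].
near: w; apply/(@nbhs_ballP _ R[i]); exists e%:C; rewrite /= ?ltcR.
Unshelve. all: by end_near. Qed.

Lemma continuous_Complex (T : topologicalType) (f g : T -> R) :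
  continuous f -> continuous g -> continuous (fun t => Complex (f t) (g t)).
Proof.
move=> cf cg t.
apply/(@cvg_ballP _ R[i]) => -[e e']; rewrite ltcE /= => /andP[/eqP -> e0].
near=> s.
rewrite /ball /= normc_def ltcR /=.
have h1 : `|f t - f s| < e / 2.
  by near: s; apply: cvgr_dist_lt; [exact: cf|rewrite divr_gt0].
have h2 : `|g t - g s| < e / 2.
  by near: s; apply: cvgr_dist_lt; [exact: cg|rewrite divr_gt0].
rewrite -[e]ger0_norm ?ltW// -sqrtr_sqr ltr_sqrt ?exprn_gt0//.
rewrite -(real_normK (num_real (f t - f s))) -(real_normK (num_real (g t - g s))).
move: (normr_ge0 (f t - f s)) (normr_ge0 (g t - g s)) h1 h2; nra.
Unshelve. all: by end_near. Qed.

End ComplexTopology.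

Section Retraction.
Variable R : realType.

Definition modulus (z : R[i]) : R :=
  Num.sqrt (complex.Re z ^+ 2 + complex.Im z ^+ 2).

Lemma modulus_continuous : continuous modulus.
Proof.
move=> z; apply: continuous_comp; last exact: sqrt_continuous.
have sq (f : R[i] -> R) : continuous f -> {for z, continuous (fun z => f z ^+ 2)}.
  by move=> cf; apply: (@continuous_comp _ _ _ f (fun t : R => t ^+ 2)); [exact: cf|exact: exprn_continuous].
apply: (@cvgD _ R _ (nbhs z) (nbhs_filter z)); apply: sq;
  [exact: Re_continuous|exact: Im_continuous].
Qed.

(** The retraction of the plane onto the closed disc makes it possible to divide
   a point of the disc by a small number and stay in the disc, continuously. *)
Definition radial (z : R[i]) : R[i] :=
  Complex (complex.Re z / Num.max 1 (modulus z))
          (complex.Im z / Num.max 1 (modulus z)).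

Lemma radial_le1 z : `|radial z| <= 1.
Proof.
have m_gt0 : 0 < Num.max 1 (modulus z) by rewrite lt_max ltr01.
rewrite normc_def -[1](@complexr0 R) lecR /=.
rewrite -[leRHS]sqrtr1 ler_sqrt // !expr_div_n -mulrDl.
rewrite ler_pdivrMr ?exprn_gt0// mul1r.
rewrite -[leLHS]sqr_sqrtr ?addr_ge0 ?sqr_ge0//.
rewrite ler_sqr ?nnegrE ?sqrtr_ge0 //; last exact: ltW.
by rewrite le_max lexx orbT.
Qed.

Lemma radial_id z : `|z| <= 1 -> radial z = z.
Proof.
rewrite normc_def -[1](@complexr0 R) lecR /radial /modulus => h.
by rewrite max_l// !divr1; case: z {h}.
Qed.

Lemma radial_continuous : continuous radial.
Proof.
have cm : continuous (fun z => (Num.max 1 (modulus z))^-1).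
  move=> z; apply: (@continuousV _ _ (fun z => Num.max 1 (modulus z))).
    by rewrite gt_eqF// lt_max ltr01.
  by apply: continuous_max; [exact: cst_continuous|exact: modulus_continuous].
by apply: continuous_Complex => z; apply: continuousM;
  [exact: Re_continuous|exact: cm|exact: Im_continuous|exact: cm].
Qed.

Lemma radial_disc_subproof z : radial z \in [set z : R[i] | `|z| <= 1].
Proof. by rewrite inE /= radial_le1. Qed.

Definition to_disc (z : R[i]) : unit_disc R := SigSub (radial_disc_subproof z).

Lemma to_discE z : disc_val (to_disc z) = radial z.
Proof. by []. Qed.

Lemma disc_val_inj : injective (@disc_val R).
Proof. exact: val_inj. Qed.

Lemma disc_val_le1 (u : unit_disc R) : `|disc_val u| <= 1.
Proof. exact: (set_valP u). Qed.

Lemma disc_valK : cancel (@disc_val R) to_disc.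
Proof. by move=> u; apply: disc_val_inj; rewrite to_discE radial_id// disc_val_le1. Qed.

Lemma disc_val_continuous : continuous (@disc_val R).
Proof. exact: initial_continuous. Qed.

Lemma to_disc_continuous : continuous to_disc.
Proof. apply: continuous_comp_initial; exact: radial_continuous. Qed.

End Retraction.

(** * Products of compact spaces *)

Lemma continuous_to_product (T : topologicalType) (I : Type)
    (K : I -> topologicalType) (f : T -> prod_topology K) :
  (forall i, continuous (fun t => f t i)) -> continuous f.
Proof.
move=> cf t; apply/cvg_sup => i.
exact: (@continuous_comp_initial _ _ _ (fun g : forall i, K i => g i) f (cf i)).
Qed.

(** Open sets of the subtype are traces of open sets of the ambient space, so
   coverings transfer. *)
Lemma compact_set_type (T : topologicalType) (A : set T) :
  compact A -> compact [set: set_type A].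
Proof.
move=> /compact_near_coveringP cA; apply/compact_near_coveringP => J F P FF H.
have := cA J F (fun i x => forall h : x \in A, P i (SigSub h)) FF.
have covers x : A x ->
    \forall x' \near x & i \near F, forall h : x' \in A, P i (SigSub h).
  move=> /mem_set hx; have [[U V] [/= nU FV] UVP] := H (SigSub hx) I.
  have [_ [[W oW <-] /= Wx WU]] := nU.
  exists (W, V) => /=; first by split=> //; exact: open_nbhs_nbhs.
  by move=> [x' i] [/= Wx' Vi] h; apply: (UVP (SigSub h, i)); split=> //; exact: WU.
move=> /(_ covers); apply: filterS => i PA [x hx] _.
exact: (PA x (set_mem hx)).
Qed.

Lemma injective_hausdorff (S T : topologicalType) (f : S -> T) :
  continuous f -> injective f -> hausdorff_space T -> hausdorff_space S.
Proof.
move=> cf f_inj hT p q pq; apply: f_inj; apply: hT => A B Ap Bq.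
have [s [As Bs]] := pq _ _ (cf p A Ap) (cf q B Bq).
by exists (f s).
Qed.

Section CountablePower.
Variable R : realType.

(** A pointwise topology has no distance for a general index set; for a countable
   one, this name is where the canonical distance is attached. *)
Definition power (T I : Type) : Type := {ptws I -> T}.

HB.instance Definition _ (T : pseudoMetricType R) (I : countType) :=
  PseudoMetric.copy (power T I) {ptws I -> T}.
HB.instance Definition _ (T : pseudoPMetricType R) (I : countType) :=
  Pointed.on (power T I).

(** Alexandroff and Hausdorff: the power is compact and metrizable. *)
Lemma cantor_onto_power (T : pseudoPMetricType R) (I : countType) :
  compact [set: T] -> hausdorff_space T ->
  exists2 f : cantor_space -> {ptws I -> T}, continuous f
    & forall q, exists b, f b = q.
Proof.
move=> cT hT.
have [||f cf] := @cantor_surj R (power T I).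
- have := @tychonoff I (fun=> T) (fun=> setT) (fun=> cT).
  suff -> : [set f : I -> T | forall i, setT (f i)] = setT by [].
  by apply/seteqP; split.
- exact: (@hausdorff_product I (fun=> T) (fun=> hT)).
- exists f => // q.
  by have [b _ <-] := @surj _ _ _ _ f q Logic.I; exists b.
Qed.

(** [D] is the distance to [A], finite because the metric of the product is bounded. *)
Lemma power_zero_set (T : pseudoMetricType R) (I : countType) (A : set {ptws I -> T}) :
  closed A -> exists D : {ptws I -> T} -> R,
    [/\ continuous D, forall y, 0 <= D y & forall y, D y = 0 <-> A y].
Proof.
move=> clA; have [A0|/set0P[a0 Aa0]] := eqVneq A set0.
  exists (fun=> 1); split=> //; first exact: cst_continuous.
  by rewrite A0 => y; split=> // /eqP; rewrite oner_eq0.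
pose d := @edist_inf R (power T I) A.
have d_fin y : d y \is a fin_num.
  rewrite ge0_fin_numE ?edist_inf_ge0//; apply: (@le_lt_trans _ _ (edist (y : power T I, a0))).
    by apply: ereal_inf_lbound; exists a0.
  rewrite -ge0_fin_numE ?edist_ge0//; apply/edist_finP => /=; exists 2 => //.
  exact: countable_uniform.countable_uniform_bounded.
exists (fine \o d); split=> [y|y|y].
- apply: fine_cvg; first exact: nbhs_filter.
  by rewrite /= fineK//; exact: (@edist_inf_continuous R (power T I) A).
- by rewrite /= fine_ge0// edist_inf_ge0.
split=> [/= dy0|Ay]; last by rewrite /= /d edist_inf0.
rewrite [A](closure_id _).1//; move=> B /(@nbhs_ballP _ (power T I))[e /= e0 eB].
have : (d y < e%:E)%E by rewrite -(fineK (d_fin y)) dy0 lte_fin.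
move=> /ereal_inf_lt[_ [b Ab <-] /edist_lt_ball yb].
by exists b; split=> //; exact: eB.
Qed.

End CountablePower.

(** * The shift space *)
Section ShiftSpaceTopology.
Variable R : realType.
Local Notation X := (shift_space R).

Lemma coordinate_continuous (k : int) : continuous (fun y : X => y k).
Proof. exact: (@proj_continuous int (fun=> unit_disc R)). Qed.

Lemma left_shift_continuous : continuous (@left_shift R).
Proof. by apply: continuous_to_product => k; exact: coordinate_continuous. Qed.

Lemma iter_left_shift n (y : X) k : iter n (@left_shift R) y k = y (k + n%:Z).
Proof.
elim: n k => [|n IHn] k; first by rewrite addr0.
by rewrite iterS /left_shift IHn; congr (y _); lia.
Qed.

(** Reading a point along the multiples of [r] and dividing by [f r] undoes, on
   the orbit of a multiplicative [f], the passage from [n] to [r * n].  Off the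
   orbit the quotient may leave the disc and is retracted. *)
Definition dilate (c : R[i]) (r : nat) (y : X) : X :=
  fun k => to_disc (disc_val (y (r%:Z * k)) / c).

Lemma dilate_continuous c r : continuous (dilate c r).
Proof.
apply: continuous_to_product => k y.
apply: (@continuous_comp _ _ _ (fun y : X => disc_val (y (r%:Z * k)) / c) (@to_disc R)).
  apply: (@continuous_comp _ _ _ (fun y : X => disc_val (y (r%:Z * k))) (fun z => z / c)).
    apply: (@continuous_comp _ _ _ (fun y : X => y (r%:Z * k)) (@disc_val R)).
      exact: coordinate_continuous.
    exact: disc_val_continuous.
  exact: (@mulrr_continuous R[i]).
exact: to_disc_continuous.
Qed.

Lemma dilate_shift c r y :
  dilate c r (iter r (@left_shift R) y) = left_shift (dilate c r y).
Proof.
apply: funext => k; rewrite /dilate /left_shift; congr (to_disc (disc_val _ / c)).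
by rewrite iter_left_shift mulrDr mulr1.
Qed.

(** Here multiplicativity enters: [f (r m) / f r = f m].  Only positive
   positions are concerned, so the extension of [f] to the integers is harmless. *)
Lemma dilate_multiplicative (f : nat -> unit_disc R) (x : X) r n k :
  completely_multiplicative f -> extends x f -> (0 < r)%N ->
  disc_val (f r) <> 0 -> 0 < k + n%:Z :> int ->
  dilate (disc_val (f r)) r (iter (r * n) (@left_shift R) x) k =
  iter n (@left_shift R) x k.
Proof.
move=> fM xf r0 fr0 kn0; rewrite /dilate !iter_left_shift.
have [m mE] : exists m : nat, k + n%:Z = m%:Z.
  by exists (absz (k + n%:Z)); lia.
have -> : r%:Z * k + (r * n)%N%:Z = (r * m)%N%:Z.
  by rewrite !PoszM -mE; ring.
have m0 : (0 < m)%N by lia.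
rewrite mE !xf ?muln_gt0 ?r0// fM// mulrAC divff ?mul1r ?disc_valK//.
exact/eqP.
Qed.

(** The disc is a quotient of a square, hence the shift space a quotient of a
   countable power of a segment: two coordinates, real and imaginary part, for
   each integer. *)
Definition segment : Type := set_type `[(-1 : R), 1]%classic.

Lemma segment_subproof : (0 : R) \in `[(-1 : R), 1]%classic.
Proof. by rewrite inE /= in_itv /= ler01 lerN10. Qed.

HB.instance Definition _ := PseudoMetric.on segment.
HB.instance Definition _ := isPointed.Build segment (SigSub segment_subproof).

Lemma compact_segment : compact [set: segment].
Proof. by apply: compact_set_type; exact: segment_compact. Qed.

Lemma hausdorff_segment : hausdorff_space segment.
Proof.
apply: (@injective_hausdorff _ R (fun u : segment => set_val u)).
- exact: initial_continuous.
- exact: val_inj.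
- exact: Rhausdorff.
Qed.

Local Notation segment_seq := {ptws (int * bool)%type -> segment}.

Definition of_segments (q : segment_seq) : X :=
  fun k => to_disc (Complex (set_val (q (k, true))) (set_val (q (k, false)))).

Lemma of_segments_continuous : continuous of_segments.
Proof.
apply: continuous_to_product => k q.
apply: (@continuous_comp _ _ _
  (fun q : segment_seq => Complex (set_val (q (k, true)) : R) (set_val (q (k, false))))
  (@to_disc R)); last exact: to_disc_continuous.
apply: continuous_Complex => {}q.
  apply: (@continuous_comp _ _ _ (fun q : segment_seq => q (k, true)) set_val).
    exact: (@proj_continuous _ (fun=> segment)).
  exact: initial_continuous.
apply: (@continuous_comp _ _ _ (fun q : segment_seq => q (k, false)) set_val).
  exact: (@proj_continuous _ (fun=> segment)).
exact: initial_continuous.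
Qed.

Lemma of_segments_surj (y : X) : exists q, of_segments q = y.
Proof.
have modulus_le1 k : complex.Re `|disc_val (y k)| <= 1.
  by have := disc_val_le1 (y k); rewrite lecE => /andP[].
have hRe k : complex.Re (disc_val (y k)) \in `[(-1 : R), 1]%classic.
  by rewrite inE /= in_itv /= -ler_norml; exact: le_trans (ler_normRe _) _.
have hIm k : complex.Im (disc_val (y k)) \in `[(-1 : R), 1]%classic.
  by rewrite inE /= in_itv /= -ler_norml; exact: le_trans (ler_normIm _) _.
exists (fun kb : int * bool => if kb.2 then SigSub (hRe kb.1) else SigSub (hIm kb.1)).
apply: funext => k; rewrite -[RHS]disc_valK /of_segments; congr to_disc.
by rewrite /= /set_val /=; case: (disc_val _).
Qed.

(** Coding by infinite sequences of bits gives compactness at once, and later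
   reduces weak limits to limits of frequencies of finite words. *)
Lemma cantor_onto_shift_space :
  exists2 phi : cantor_space -> X, continuous phi & forall y, exists b, phi b = y.
Proof.
have [f cf sf] :=
  @cantor_onto_power R segment (int * bool)%type compact_segment hausdorff_segment.
exists (of_segments \o f) => [b|y].
  by apply: continuous_comp; [exact: cf|exact: of_segments_continuous].
have [q <-] := of_segments_surj y.
by have [b <-] := sf q; exists b.
Qed.

Lemma shift_space_compact : compact [set: X].
Proof.
have [phi cphi sphi] := cantor_onto_shift_space.
have -> : [set: X] = phi @` setT.
  by apply/seteqP; split=> // y _; have [b <-] := sphi y; exists b.
apply: continuous_compact; last exact: cantor_space_compact.
exact: continuous_subspaceT.
Qed.

(** A basic neighbourhood constrains finitely many coordinates only; [rank]
   orders the coordinates so that a bound on the rank captures them. *)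
Lemma nbhs_finite_coordinates (I : choiceType) (rank : I -> nat)
    (K : I -> topologicalType) (y : prod_topology K) (A : set (prod_topology K)) :
  nbhs y A -> exists (m : nat) (C : set (prod_topology K)),
    [/\ nbhs y C, C `<=` A & forall y' z : prod_topology K,
      (forall i, (rank i < m)%N -> y' i = z i) -> C y' -> C z].
Proof.
rewrite {1}nbhsE => -[_ [[B sB <-] [C BC Cy] sUB]].
have [D Dsub DC] := sB _ BC.
pose s : seq (set (prod_topology K)) := finmap.enum_fset D.
have sP E : E \in s -> exists i, exists2 W, open W & (fun y => y i) @^-1` W = E.
  by move=> /Dsub/set_mem[i _ [W oW WE]]; exists i, W.
have {}DC : \bigcap_(E in [set` s]) E = C := DC.
have /choice[g gP] : forall E : set (prod_topology K), exists m,
    E \in s -> forall y z : prod_topology K,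
    (forall i, (rank i < m)%N -> y i = z i) -> E y -> E z.
  move=> E; have [ED|] := boolP (E \in s); last by exists 0%N.
  have [i [W oW <-]] := sP E ED.
  by exists (rank i).+1 => _ y1 z1 yz /=; rewrite -yz.
exists (\max_(E <- s) g E)%N, C; split.
- have near_s (t : seq (set (prod_topology K))) : {subset t <= s} ->
      (forall E, E \in t -> E y) -> \forall z \near y, forall E, E \in t -> E z.
    elim: t => [|E t IHt] ts ty; first by apply: filterE => z.
    have nE : \forall z \near y, E z.
      have [|i [W oW WE]] := sP E; first by apply: ts; rewrite inE eqxx.
      rewrite -WE; apply: (@proj_continuous _ K i y); apply: open_nbhs_nbhs.
      by split=> //; have := ty E (mem_head _ _); rewrite -WE.
    have nt : \forall z \near y, forall E, E \in t -> E z.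
      by apply: IHt => E' E't; [apply: ts|apply: ty]; rewrite inE E't orbT.
    apply: filterS2 nE nt => z Ez tz E'.
    by rewrite inE => /predU1P[->//|]; exact: tz.
  have -> : C = [set z | forall E, E \in s -> E z] by rewrite -DC.
  by apply: (near_s s) => // E Es; move: Cy; rewrite -DC; exact.
- by move=> z Cz; apply: sUB; exists C.
- move=> y' z yz Cy'; rewrite -DC => E Es; apply: (gP E Es y') => [i iE|].
    by apply: yz; apply: leq_trans iE _; exact: leq_bigmax_seq.
  by move: Cy'; rewrite -DC; exact.
Qed.

(** Uniform continuity, expressed on coordinates; compactness makes the bound [n]
   independent of the point. *)
Lemma continuous_finite_coordinates (I : choiceType) (rank : I -> nat)
    (K : I -> topologicalType) (F : prod_topology K -> R) (e : R) :
  compact [set: prod_topology K] -> continuous F -> 0 < e ->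
  exists n, forall y z : prod_topology K,
    (forall i, (rank i < n)%N -> y i = z i) -> `|F y - F z| < e.
Proof.
move=> /compact_near_coveringP cK cF e0.
have := cK nat \oo (fun n y => forall z : prod_topology K,
  (forall i, (rank i < n)%N -> y i = z i) -> `|F y - F z| < e) _.
have near_all y : [set: prod_topology K] y -> \forall y' \near y & n \near \oo,
    forall z : prod_topology K,
    (forall i, (rank i < n)%N -> y' i = z i) -> `|F y' - F z| < e.
  move=> _; have : nbhs y [set y' | `|F y - F y'| < e / 2].
    have /(@cvgrPdist_lt _ R _ _ (nbhs_filter y)) := cF y; apply.
    by rewrite divr_gt0.
  move=> /(nbhs_finite_coordinates rank)[m [C [nC CF Cm]]].
  exists (C, [set n | (m <= n)%N]) => /=; first by split=> //; exists m.
  move=> [y' n] [/= Cy' mn] z yz.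
  have Cz : C z by apply: Cm Cy' => i im; apply: yz; exact: leq_trans im mn.
  have h1 : `|F y - F y'| < e / 2 := CF _ Cy'.
  have h2 : `|F y - F z| < e / 2 := CF _ Cz.
  rewrite (splitr e); apply: le_lt_trans (ltrD h1 h2).
  by rewrite (distrC _ (F y')); exact: ler_distD.
move=> /(_ _ near_all)[n _ H].
by exists n => y z; apply: (H n _ y Logic.I z) => /=.
Qed.

(** Real and imaginary parts embed the shift space in a countable power of the
   line, which has a distance function to the compact image of [A]. *)
Lemma closed_zero_set (A : set X) : closed A ->
  exists D : X -> R, [/\ continuous D, forall y, 0 <= D y & forall y, D y = 0 <-> A y].
Proof.
move=> clA.
pose iota (y : X) : {ptws (int * bool)%type -> R} := fun kb =>
  if kb.2 then complex.Re (disc_val (y kb.1)) else complex.Im (disc_val (y kb.1)).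
have ciota : continuous iota.
  apply: continuous_to_product => -[k b] y.
  have cz : {for y, continuous (fun y : X => disc_val (y k))}.
    apply: (@continuous_comp _ _ _ (fun y : X => y k) (@disc_val R)).
      exact: coordinate_continuous.
    exact: disc_val_continuous.
  case: b => /=.
    exact: (@continuous_comp _ _ _ (fun y : X => disc_val (y k)) _ _ cz (@Re_continuous R _)).
  exact: (@continuous_comp _ _ _ (fun y : X => disc_val (y k)) _ _ cz (@Im_continuous R _)).
have iota_inj : injective iota.
  move=> y z yz; apply: funext => k; apply: disc_val_inj.
  have := congr1 (@^~ (k, true)) yz; have := congr1 (@^~ (k, false)) yz.
  by rewrite /iota /=; case: (disc_val (y k)) (disc_val (z k)) => [? ?] [? ?] /= -> ->.
have clIA : closed (iota @` A).
  apply: compact_closed.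
    exact: (@hausdorff_product (int * bool)%type (fun=> R) (fun=> @Rhausdorff R)).
  apply: continuous_compact; first exact: continuous_subspaceT.
  exact: (subclosed_compact clA shift_space_compact).
have [D [cD D0 DA]] := power_zero_set clIA.
exists (D \o iota); split=> [y|y|y]; last 1 first.
- split=> [/DA[z Az /iota_inj <-]//|Ay]; first by apply/DA; exists y.
- by apply: continuous_comp; [exact: ciota|exact: cD].
- exact: D0.
Qed.

End ShiftSpaceTopology.

(** * Borel sets, regularity and domination of measures *)
Section Borel.
Variable R : realType.
Local Notation X := (shift_space R).

Lemma open_borel (A : set X) : open A -> measurable A.
Proof. by move=> oA; exact: sub_sigma_algebra. Qed.

Lemma closed_borel (A : set X) : closed A -> measurable A.
Proof. by move=> cA; rewrite -[A]setCK; apply: measurableC; apply: open_borel; exact: closed_openC. Qed.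

Lemma continuous_borel_real (F : X -> R) : continuous F -> measurable_fun setT F.
Proof.
move=> cF; apply: (measurability _ (measurable_realfun.RGenOInfty.measurableE R)) => _ [_ [x ->] <-].
rewrite setTI; apply: open_borel; apply: open_comp => [y _|]; [exact: cF|exact: interval_open].
Qed.

Lemma continuous_borel (S : X -> X) : continuous S -> measurable_fun setT S.
Proof.
move=> cS; apply: (measurability (@open X)) => //.
move=> _ [A oA <-]; rewrite setTI; apply: open_borel; apply: open_comp => // y _; exact: cS.
Qed.

(** With [D] vanishing exactly on [A], take [U n = {D < 1/(n+1)}] and
   [F n = max 0 (1 - (n+1) D)]. *)
Lemma closed_approximation (A : set X) : closed A ->
  exists (U : nat -> set X) (F : nat -> X -> R),
    [/\ forall n, open (U n), {homo U : n m / (n <= m)%N >-> m `<=` n},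
        \bigcap_n U n = A, forall n, continuous (F n)
      & forall n y, \1_A y <= F n y <= \1_(U n) y].
Proof.
move=> /closed_zero_set[D [cD D0 DA]].
exists (fun n => D @^-1` `]-oo, n.+1%:R^-1[%classic).
exists (fun n y => Num.max 0 (1 - n.+1%:R * D y)); split.
- by move=> n; apply: open_comp => [y _|]; [exact: cD|exact: interval_open].
- move=> n m nm y /=; rewrite !in_itv/= => /lt_le_trans; apply.
  by rewrite lef_pV2 ?posrE ?ltr0n// ler_nat.
- apply/seteqP; split=> y.
    move=> Uy; apply/DA/eqP; rewrite eq_le D0 andbT leNgt; apply/negP => Dy0.
    have [n nD] : exists n, n.+1%:R^-1 < D y.
      exists (Num.truncn (D y)^-1); rewrite invf_plt ?posrE//.
      exact: truncnS_gt.
    by have := Uy n Logic.I; rewrite /= in_itv/= ltNge (ltW nD).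
  by move=> /DA Dy0 n _ /=; rewrite in_itv/= Dy0 invr_gt0.
- move=> n y; apply: (@continuous_max R X (fun=> 0) (fun y => 1 - n.+1%:R * D y) y).
    exact: cst_continuous.
  apply: (@cvgB _ R _ (nbhs y) (nbhs_filter y)).
    exact: (@cvg_cst R _ _ (nbhs y) (nbhs_filter y)).
  apply: (@cvgM R _ (nbhs y) (nbhs_filter y)); last exact: cD.
  exact: (@cvg_cst R _ _ (nbhs y) (nbhs_filter y)).
- move=> n y; rewrite !indicE; apply/andP; split.
    case: (boolP (y \in A)) => [/set_mem/DA ->|_] /=.
      by rewrite mulr0 subr0 le_max lexx orbT.
    by rewrite le_max lexx.
  case: (boolP (y \in _)) => /= [_|].
    by rewrite ge_max ler01 lerBlDr lerDl mulr_ge0.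
  rewrite notin_setE /= in_itv/= => /negP; rewrite -leNgt => Dn.
  by rewrite ge_max lexx subr_le0 -ler_pdivrMl ?ltr0n// mulr1.
Qed.

Lemma continuous_bounded (F : X -> R) : continuous F ->
  exists2 M, 0 <= M & forall y, `|F y| <= M.
Proof.
move=> cF.
have /compact_bounded[M [_ /(_ (`|M| + 1))]] : compact (F @` setT).
  apply: continuous_compact; first exact: continuous_subspaceT.
  exact: shift_space_compact.
rewrite (le_lt_trans (ler_norm _)) ?ltrDl// => /(_ isT) bF.
by exists (`|M| + 1) => [|y]; [rewrite addr_ge0|apply: bF; exists y].
Qed.

Lemma continuous_integrable (mu : probability X R) (F : X -> R) :
  continuous F -> mu.-integrable setT (EFin \o F).
Proof.
move=> cF; have [M _ FM] := continuous_bounded cF.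
apply: measurable_bounded_integrable => //.
- by rewrite (le_lt_trans (probability_le1 _ _)) ?ltry.
- exact: continuous_borel_real.
- by exists M; split; [exact: num_real|move=> N MN y _; exact: le_trans (FM y) (ltW MN)].
Qed.

Lemma Rintegral_continuous (mu : probability X R) (F : X -> R) :
  continuous F -> (\int[mu]_y F y)%:E = (\int[mu]_y (F y)%:E)%E.
Proof.
by move=> cF; rewrite fineK//; apply: integrable_fin_num => //; exact: continuous_integrable.
Qed.

(** The sets approximable from inside by closed sets and from outside by open
   sets form a sigma-algebra that contains the open sets. *)
Lemma borel_regular (mu : probability X R) (A : set X) :
  measurable A -> forall e : R, 0 < e -> exists K U : set X,
    [/\ closed K, open U, K `<=` A, A `<=` U & (mu (U `\` K) < e%:E)%E].
Proof.
move: A; apply: smallest_sub => [|A oA e e0]; last first.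
  have [U [_ [oU ndU UA _ _]]] := closed_approximation (open_closedC oA).
  have : (fun n => mu (U n `\` ~` A)) @ \oo --> mu (\bigcap_n (U n `\` ~` A)).
    apply: (@nonincreasing_cvg_mu _ _ _ mu (fun n => U n `\` ~` A)).
    - by rewrite (le_lt_trans (probability_le1 _ _)) ?ltry//; apply: measurableD;
        [exact: open_borel|apply: measurableC; exact: open_borel].
    - by move=> n; apply: measurableD; [exact: open_borel|apply: measurableC; exact: open_borel].
    - apply: bigcapT_measurable => n.
      by apply: measurableD; [exact: open_borel|apply: measurableC; exact: open_borel].
    - by move=> m n mn; apply/subsetPset => y [Uy Ay]; split=> //; exact: (ndU _ _ mn).
  have -> : \bigcap_n (U n `\` ~` A) = set0.
    rewrite -subset0 => y UAy; have : (\bigcap_n U n) y by move=> n _; have [] := UAy n Logic.I.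
    by rewrite UA => nAy; have [] := UAy 0%N Logic.I.
  rewrite measure0 => /fine_cvgP[_ /cvgrPdist_lt/(_ _ e0)[n _ /(_ n (leqnn n))]] /=.
  rewrite sub0r normrN => mun.
  exists (~` U n), A; split=> //.
  - exact: open_closedC.
  - move=> y nUy; apply: contrapT => nAy; apply: nUy.
    have : (\bigcap_n U n) y by rewrite UA.
    by move=> /(_ n Logic.I).
  - rewrite setDE setCK setIC -[A in _ `&` A]setCK -setDE.
    have fin : mu (U n `\` ~` A) \is a fin_num.
      by apply: fin_num_measure; apply: measurableD;
        [exact: open_borel|apply: measurableC; exact: open_borel].
    rewrite -(fineK fin) lte_fin; apply: le_lt_trans mun; exact: ler_norm.
split=> [e e0|A regA e e0|A regA e e0].
- exists set0, set0; split; rewrite ?set0D ?measure0 ?lte_fin//.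
  exact: closed0. exact: open0.
- have [K [U [cK oU KA AU KU]]] := regA e e0.
  exists (~` U), (~` K); split.
  + exact: open_closedC.
  + exact: closed_openC.
  + by rewrite setTD; exact: subsetC.
  + by rewrite setTD; exact: subsetC.
  + by rewrite setDE setCK setIC -setDE.
(* Half of [e] bounds the errors of all the [A n]; the other half pays for
   replacing the countable union of closed sets by a finite one. *)
have e2 n : 0 < e / 2 / (2 ^ n.+1)%:R by rewrite !divr_gt0// ltr0n expn_gt0.
have /choice[KU KUP] : forall n, exists KU : set X * set X,
    [/\ closed KU.1, open KU.2, KU.1 `<=` A n, A n `<=` KU.2 &
     (mu (KU.2 `\` KU.1) < (e / 2 / (2 ^ n.+1)%:R)%:E)%E].
  by move=> n; have [K [U KUP]] := regA n _ (e2 n); exists (K, U).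
pose U := \bigcup_n (KU n).2; pose L n := \big[setU/set0]_(i < n) (KU i).1.
have LE n : L n = \bigcup_(i in `I_n) (KU i).1 by rewrite /L bigcup_mkord.
have cK n : closed (KU n).1 by have [] := KUP n.
have oU n : open (KU n).2 by have [] := KUP n.
have oUU : open U by exact: bigcup_open.
have cL n : closed (L n) by apply: closed_bigsetU => i _.
have mUL n : measurable (U `\` L n).
  by apply: measurableD; [exact: open_borel|exact: closed_borel].
have : (fun n => mu (U `\` L n)) @ \oo --> mu (\bigcap_n (U `\` L n)).
  apply: (@nonincreasing_cvg_mu _ _ _ mu (fun n => U `\` L n)) => //.
  - by rewrite (le_lt_trans (probability_le1 _ _)) ?ltry.
  - exact: bigcapT_measurable.
  - move=> m n mn; apply/subsetPset; apply: setDS => y.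
    by rewrite !LE => -[i /= im Ky]; exists i => //=; exact: leq_trans im mn.
have small : (mu (\bigcap_n (U `\` L n)) <= (e / 2)%:E)%E.
  apply: (@le_trans _ _ (\sum_(n <oo) mu ((KU n).2 `\` (KU n).1))%E).
    apply: measure_sigma_subadditive.
    - by move=> n; apply: measurableD; [exact: open_borel|exact: closed_borel].
    - exact: bigcapT_measurable.
    - move=> y UL; have [[n _ Uy] _] := UL 0%N Logic.I.
      exists n => //; split=> // Ky; have [_] := UL n.+1 Logic.I; apply.
      by rewrite /L big_ord_recr; right.
  apply: le_trans (@epsilon_trick0 R (e / 2) xpredT _); last by rewrite divr_ge0 ?ltW.
  by apply: lee_nneseries => // n _; apply: ltW; have [] := KUP n.
have lim_fin : mu (\bigcap_n (U `\` L n)) \is a fin_num.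
  by apply: fin_num_measure; exact: bigcapT_measurable.
rewrite -(fineK lim_fin) => /fine_cvgP[_ /cvgrPdist_lt/(_ (e / 2))].
rewrite divr_gt0// => /(_ isT)[n _ /(_ n (leqnn n))] /= dist.
exists (L n), U; split=> //.
- move=> y; rewrite LE => -[i _ Ky]; exists i => //.
  by have [_ _ + _ _] := KUP i; apply.
- by move=> y [i _ Ay]; exists i => //; have [_ _ _ + _] := KUP i; apply.
rewrite -(@fineK _ (mu (U `\` L n))) ?fin_num_measure// lte_fin.
move: small dist; rewrite -(fineK lim_fin) lee_fin => small.
rewrite distrC => /(le_lt_trans (ler_norm _)); lra.
Qed.

(** For closed sets, integrate continuous functions that decrease to the
   indicator; inner regularity of [mu] then reaches all Borel sets.  Weak limits
   are known through continuous functions only, and this is how inequalities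
   between them become inequalities between measures. *)
Lemma integral_domination (mu lam : probability X R) (S : X -> X) (C : R) :
  continuous S -> 0 <= C ->
  (forall F : X -> R, continuous F -> (forall y, 0 <= F y) ->
     \int[mu]_y F y <= C * \int[lam]_y F (S y)) ->
  forall A, measurable A -> (mu A <= C%:E * lam (S @^-1` A))%E.
Proof.
move=> cS C0 dom.
have mS A : measurable A -> measurable (S @^-1` A).
  by move=> mA; rewrite -[X in measurable X]setTI; exact: continuous_borel cS _ _ mA.
have domK K : closed K -> (mu K <= C%:E * lam (S @^-1` K))%E.
  move=> cK; have [U [F [oU ndU UK cF F01]]] := closed_approximation cK.
  have mK := closed_borel cK.
  have F0 n y : 0 <= F n y.
    by have /andP[+ _] := F01 n y; apply: le_trans; rewrite indicE.
  have cFS n : continuous (F n \o S).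
    by move=> y; apply: continuous_comp; [exact: cS|exact: cF].
  have mF n : measurable_fun [set: X] (fun y : X => (F n y)%:E).
    by apply/measurable_EFinP; exact: continuous_borel_real.
  have muU n : (mu K <= C%:E * lam (S @^-1` U n))%E.
    apply: (@le_trans _ _ (\int[mu]_y (F n y)%:E)%E).
      rewrite -(setIT K) -integral_indic//; apply: ge0_le_integral => //.
      - by apply/measurable_EFinP; exact: measurable_indic.
      - by move=> y _; rewrite lee_fin; have /andP[] := F01 n y.
    rewrite -Rintegral_continuous//.
    apply: (@le_trans _ _ (C%:E * (\int[lam]_y F n (S y))%:E)%E).
      by rewrite -EFinM lee_fin; exact: dom.
    apply: lee_wpmul2l; rewrite ?lee_fin// (@Rintegral_continuous _ (F n \o S))//.
    rewrite -(setIT (S @^-1` U n)) -integral_indic//; last by apply: mS; exact: open_borel.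
    apply: ge0_le_integral => //.
    - by move=> y _; rewrite lee_fin; exact: F0.
    - by apply/measurable_EFinP; exact: continuous_borel_real.
    - by apply/measurable_EFinP; apply: measurable_indic; apply: mS; exact: open_borel.
    - by move=> y _; rewrite lee_fin; have /andP[] := F01 n (S y).
  have cvgU : (fun n => C%:E * lam (S @^-1` U n))%E @ \oo -->
      (C%:E * lam (S @^-1` K))%E.
    apply: cvgeZl => //; rewrite -[in X in _ --> X]UK preimage_bigcap.
    apply: (@nonincreasing_cvg_mu _ _ _ lam (fun n => S @^-1` U n)).
    - by rewrite (le_lt_trans (probability_le1 _ _)) ?ltry//; apply: mS; exact: open_borel.
    - by move=> n; apply: mS; exact: open_borel.
    - by apply: bigcapT_measurable => n; apply: mS; exact: open_borel.
    - by move=> m n mn; apply/subsetPset; apply: preimage_subset; exact: ndU.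
  by rewrite -(cvg_lim _ cvgU)//; apply: lime_ge; [apply/cvg_ex; eexists; exact: cvgU|exact: nearW].
move=> A mA; apply/lee_addgt0Pr => e e0.
have [K [U [cK oU KA AU KU]]] := borel_regular mu mA e0.
have mK := closed_borel cK.
apply: (@le_trans _ _ (mu K + mu (U `\` K))%E).
  rewrite -measureU//; last 2 first.
  - apply: measurableD => //; exact: open_borel.
  - by rewrite setDE setICA setICr setI0.
  apply: le_measure; rewrite ?inE//.
    apply: measurableU => //; apply: measurableD => //; exact: open_borel.
  by move=> y Ay; have [Ky|nKy] := pselect (K y); [left|right; split => //; exact: AU].
apply: leeD; last exact: ltW.
apply: le_trans (domK _ cK) _; apply: lee_wpmul2l; rewrite ?lee_fin//.
by apply: le_measure; rewrite ?inE; [exact: mS|exact: mS|exact: preimage_subset].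
Qed.

End Borel.

(** * Characters of cyclic groups *)
Section Exponential.
Variable R : realType.

Lemma expiD (s t : R) : expi (s + t) = expi s * expi t.
Proof.
rewrite /expi mulrDr cosD sinD; apply/eqP.
by rewrite eq_complex /= eqxx /= addrC.
Qed.

Lemma expi0 : expi 0 = 1 :> R[i].
Proof. by rewrite /expi mulr0 cos0 sin0. Qed.

Lemma norm_expi (t : R) : `|expi t| = 1.
Proof. by rewrite normc_def /= cos2Dsin2 sqrtr1. Qed.

Lemma expi_neq0 (t : R) : expi t != 0.
Proof. by rewrite -normr_eq0 norm_expi oner_eq0. Qed.

Lemma expi_nat (n : nat) : expi n%:R = 1 :> R[i].
Proof.
elim: n => [|n IHn]; first exact: expi0.
by rewrite -natr1 expiD IHn mul1r /expi mulr1 mulr_natl cos2pi sin2pi.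
Qed.

Lemma expi_neq1 (t : R) : 0 < t < 1 -> expi t != 1.
Proof.
move=> /andP[t0 t1]; rewrite eq_complex /= negb_and; apply/orP; left.
have sin_gt0 : 0 < sin (pi * t).
  by apply: sin_gt0_pi; rewrite mulr_gt0 ?pi_gt0//= -[ltRHS]mulr1 ltr_pM2l ?pi_gt0.
have -> : 2 * pi * t = (pi * t) *+ 2 by rewrite mulr2n; ring.
rewrite cos_mulr2n; apply/eqP => cos_eq1.
have := cos2Dsin2 (pi * t); have : 0 < sin (pi * t) ^+ 2 by rewrite exprn_gt0.
move: cos_eq1; rewrite mulr2n; lra.
Qed.

Lemma expiMn (t : R) (n : nat) : expi (t *+ n) = expi t ^+ n.
Proof.
by elim: n => [|n IHn]; rewrite ?mulr0n ?expr0 ?expi0// mulrS exprS expiD IHn.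
Qed.

(** Orthogonality of the characters of the cyclic group of order [r]. *)
Lemma sum_expi (r j : nat) : (j < r)%N ->
  \sum_(k < r) expi (- (j%:R * k%:R / r%:R)) = (if j == 0%N then r%:R else 0) :> R[i].
Proof.
move=> jr; have r0 : r%:R != 0 :> R by rewrite pnatr_eq0 -lt0n (leq_ltn_trans _ jr).
have [->|j0] := eqVneq j 0%N.
  rewrite (eq_bigr (fun=> 1)) ?sumr_const ?card_ord// => k _.
  by rewrite !mul0r oppr0 expi0.
pose z : R[i] := expi (- (j%:R / r%:R)).
have -> : \sum_(k < r) expi (- (j%:R * k%:R / r%:R)) = \sum_(k < r) z ^+ k.
  apply: eq_bigr => k _; rewrite -expiMn mulNrn -(mulr_natr (j%:R / r%:R)).
  by congr (expi (- _)); rewrite mulrAC.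
have z1 : z != 1.
  rewrite -[1](expi_nat 1) /z; apply/eqP => h.
  have : expi (1 - j%:R / r%:R) = 1 :> R[i] by rewrite expiD h expi_nat mul1r.
  apply/eqP/expi_neq1.
  have r_gt0 : 0 < r%:R :> R by rewrite ltr0n (leq_ltn_trans _ jr).
  rewrite subr_gt0 ltr_pdivrMr// mul1r ltr_nat jr /=.
  by rewrite ltrBlDr ltrDl divr_gt0// ltr0n lt0n.
have zr : z ^+ r = 1.
  rewrite -expiMn mulNrn -(mulr_natr (j%:R / r%:R)) divfK//.
  have : expi (- j%:R) * expi j%:R = 1 :> R[i] by rewrite -expiD addNr expi0.
  by rewrite expi_nat mulr1.
by have /eqP := subrX1 z r; rewrite zr subrr eq_sym mulf_eq0 subr_eq0 (negbTE z1) => /eqP.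
Qed.

End Exponential.

(** * Complex-valued measurable functions *)
Section ComplexMeasurable.
Context {d} {T : measurableType d} {R : realType}.

Definition cmeasurable (g : T -> R[i]) :=
  measurable_fun setT (fun y => complex.Re (g y)) /\
  measurable_fun setT (fun y => complex.Im (g y)).

Lemma cmeasurable_cst z : cmeasurable (fun=> z).
Proof. by split; exact: measurable_cst. Qed.

Lemma cmeasurableD g h : cmeasurable g -> cmeasurable h ->
  cmeasurable (fun y => g y + h y).
Proof.
move=> [mg1 mg2] [mh1 mh2]; split.
  rewrite (_ : (fun y => _) = (fun y => complex.Re (g y)) \+ (fun y => complex.Re (h y))).
    exact: measurable_funD.
  by apply: funext => y /=; case: (g y) (h y) => [? ?] [? ?].
rewrite (_ : (fun y => _) = (fun y => complex.Im (g y)) \+ (fun y => complex.Im (h y))).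
  exact: measurable_funD.
by apply: funext => y /=; case: (g y) (h y) => [? ?] [? ?].
Qed.

Lemma cmeasurableM g h : cmeasurable g -> cmeasurable h ->
  cmeasurable (fun y => g y * h y).
Proof.
move=> [mg1 mg2] [mh1 mh2]; split.
  rewrite (_ : (fun y => _) = (fun y => complex.Re (g y)) \* (fun y => complex.Re (h y))
    \- (fun y => complex.Im (g y)) \* (fun y => complex.Im (h y))).
    by apply: measurable_funB; exact: measurable_funM.
  by apply: funext => y /=; case: (g y) (h y) => [? ?] [? ?].
rewrite (_ : (fun y => _) = (fun y => complex.Re (g y)) \* (fun y => complex.Im (h y))
  \+ (fun y => complex.Im (g y)) \* (fun y => complex.Re (h y))).
  by apply: measurable_funD; exact: measurable_funM.
by apply: funext => y /=; case: (g y) (h y) => [? ?] [? ?].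
Qed.

Lemma cmeasurable_sum (I : Type) (s : seq I) (g : I -> T -> R[i]) :
  (forall i, cmeasurable (g i)) -> cmeasurable (fun y => \sum_(i <- s) g i y).
Proof.
move=> mg; elim: s => [|i s IHs].
  by under eq_fun do rewrite big_nil; exact: cmeasurable_cst.
by under eq_fun do rewrite big_cons; exact: cmeasurableD.
Qed.

Lemma cmeasurable_real (f : T -> R) :
  measurable_fun setT f -> cmeasurable (fun y => (f y)%:C).
Proof. by move=> mf; split => //; exact: measurable_cst. Qed.

Lemma cmeasurable_eq0 g : cmeasurable g -> measurable [set y | g y = 0].
Proof.
move=> [mg1 mg2].
rewrite (_ : [set y | _] = (fun y => complex.Re (g y)) @^-1` [set 0] `&`
                          (fun y => complex.Im (g y)) @^-1` [set 0]).
  by apply: measurableI; [rewrite -[X in measurable X]setTI; exact: mg1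
                        |rewrite -[X in measurable X]setTI; exact: mg2].
by apply/seteqP; split=> y /=; case: (g y) => a b /=; [case=> -> ->|case=> -> ->].
Qed.

End ComplexMeasurable.

Lemma cmeasurable_comp d d' (T : measurableType d) (U : measurableType d')
    (R : realType) (S : T -> U) (g : U -> R[i]) :
  measurable_fun setT S -> cmeasurable g -> cmeasurable (g \o S).
Proof. by move=> mS [mg1 mg2]; split; [exact: (measurableT_comp mg1 mS)|exact: (measurableT_comp mg2 mS)]. Qed.

(** * Null sets *)
Section AbsoluteContinuity.

(** Exhaustion: [B] is a [mu]-null set whose preimage has the largest possible
   [nu]-measure.  Outside [B] every [mu]-null set is null for the image of [nu],
   which is what is needed of a Lebesgue decomposition. *)
Lemma null_set_exhaustion d d' (T : measurableType d) (U : measurableType d')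
    (R : realType) (mu : probability T R) (nu : probability U R) (S : U -> T) :
  measurable_fun setT S ->
  exists B, [/\ measurable B, mu B = 0%E
    & forall E, measurable E -> mu E = 0%E -> nu (S @^-1` (E `\` B)) = 0%E].
Proof.
move=> mS.
have mpre E : measurable E -> measurable (S @^-1` E).
  by move=> mE; rewrite -[X in measurable X]setTI; exact: mS.
pose V := [set nu (S @^-1` B) | B in [set B | measurable B /\ mu B = 0%E]].
pose s := ereal_sup V.
have s_le1 : (s <= 1)%E.
  by apply: ge_ereal_sup => _ [B [mB _] <-]; apply: probability_le1; exact: mpre.
have s_ge0 : (0 <= s)%E.
  apply: ereal_sup_ubound; exists set0; last by rewrite preimage_set0 measure0.
  by split; [exact: measurable0|exact: measure0].
have s_fin : s \is a fin_num by rewrite ge0_fin_numE// (le_lt_trans s_le1)// ltry.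
have /choice[B_ B_P] : forall n, exists B,
    [/\ measurable B, mu B = 0%E & (s - n.+1%:R^-1%:E < nu (S @^-1` B))%E].
  move=> n; have [|_ [B [mB B0] <-] sB] := @ub_ereal_sup_adherent _ V n.+1%:R^-1 _ s_fin.
    by rewrite invr_gt0 ltr0n.
  by exists B.
have mB_ n : measurable (B_ n) by have [] := B_P n.
pose B := \bigcup_n B_ n.
have mB : measurable B by exact: bigcupT_measurable.
have B0 : mu B = 0%E.
  apply/negligibleP => //; apply: negligible_bigcup => n.
  by apply/negligibleP => //; have [] := B_P n.
have sB : (s <= nu (S @^-1` B))%E.
  apply/lee_addgt0Pr => e e0.
  pose n := Num.truncn e^-1.
  have ne : n.+1%:R^-1 <= e.
    by rewrite invf_ple ?posrE ?ltr0n//; apply: ltW; exact: truncnS_gt.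
  have [_ _ /ltW] := B_P n.
  rewrite leeBlDr// => /le_trans; apply; apply: leeD; last by rewrite lee_fin.
  by apply: le_measure; rewrite ?inE; [exact: mpre|exact: mpre|move=> y By; exists n].
exists B; split=> // E mE E0.
have mEB : measurable (E `\` B) by exact: measurableD.
have : (nu (S @^-1` (B `|` (E `\` B))) <= s)%E.
  apply: ereal_sup_ubound; exists (B `|` (E `\` B)) => //; split.
    exact: measurableU.
  apply/negligibleP; first exact: measurableU.
  apply: negligibleU; first exact/negligibleP.
  by apply: (@negligibleS _ _ _ _ E); [exact: subDsetl|exact/negligibleP].
rewrite preimage_setU measureU; [|exact: mpre|exact: mpre|]; last first.
  by rewrite -preimage_setI setDE setICA setICr setI0 preimage_set0.
move=> h; have := le_trans h sB; rewrite -[leRHS]adde0 leeD2lE; last first.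
  by rewrite fin_num_measure//; exact: mpre.
by move=> h0; apply/eqP; rewrite eq_le h0 measure_ge0.
Qed.

End AbsoluteContinuity.

(** * Eigenfunctions *)
Section Spectrum.
Variable R : realType.
Local Notation X := (shift_space R).
Local Notation T := (@left_shift R).

Definition shift_invariant (mu : probability X R) :=
  forall A, measurable A -> mu (T @^-1` A) = mu A.

Lemma left_shift_borel : measurable_fun setT T.
Proof. apply: continuous_borel; exact: left_shift_continuous. Qed.

Lemma iter_left_shift_borel n : measurable_fun setT (iter n T).
Proof.
elim: n => [|n IHn]; first exact: measurable_id.
exact: (measurableT_comp left_shift_borel IHn).
Qed.

Lemma borel_preimage (S : X -> X) A :
  measurable_fun setT S -> measurable A -> measurable (S @^-1` A).
Proof. by move=> mS mA; rewrite -[X in measurable X]setTI; exact: mS. Qed.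

Lemma shift_invariant_iter mu n A : shift_invariant mu -> measurable A ->
  mu (iter n T @^-1` A) = mu A.
Proof.
move=> inv; elim: n A => [|n IHn] A mA //.
rewrite -[RHS]inv// -[RHS]IHn//.
exact: borel_preimage left_shift_borel mA.
Qed.

Lemma negligible_iter mu n N : shift_invariant mu ->
  mu.-negligible N -> mu.-negligible (iter n T @^-1` N).
Proof.
move=> inv [A [mA A0 NA]]; exists (iter n T @^-1` A); split.
- exact: borel_preimage (iter_left_shift_borel n) mA.
- by rewrite shift_invariant_iter.
- by move=> y /= Ny; exact: NA.
Qed.

Lemma spectrum_intro (mu : probability X R) (alpha M : R) (g : X -> R[i]) :
  0 <= alpha < 1 -> cmeasurable g -> (forall y, `|g y| <= M%:C) ->
  ~ {ae mu, forall y, g y = 0} ->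
  {ae mu, forall y, g (T y) = expi alpha * g y} -> spectrum mu alpha.
Proof.
move=> a01 [mg1 mg2] gM g0 gT; split=> //; exists g; split=> //; split=> //.
have M0 : 0 <= M by have := le_trans (normr_ge0 _) (gM point); rewrite -[0](@complexr0 R) lecR.
have mn : measurable_fun [set: X]
    (fun y => complex.Re (g y) ^+ 2 + complex.Im (g y) ^+ 2).
  apply: (@measurable_funD _ X R setT (fun y => complex.Re (g y) ^+ 2)
    (fun y => complex.Im (g y) ^+ 2)); exact: measurable_funX.
have /integrableP[_] : mu.-integrable setT
    (EFin \o (fun y => complex.Re (g y) ^+ 2 + complex.Im (g y) ^+ 2)).
  apply: measurable_bounded_integrable => //.
    by rewrite (le_lt_trans (probability_le1 _ _)) ?ltry.
  exists (M ^+ 2); split; [exact: num_real|move=> N MN y _].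
  rewrite /= ger0_norm ?addr_ge0 ?sqr_ge0//; apply: le_trans (ltW MN).
  rewrite -lecR add_Re2_Im2 rmorphXn /=.
  by rewrite ler_sqr ?nnegrE ?normr_ge0// -[0](@complexr0 R) lecR.
apply: le_lt_trans; apply: ge0_le_integral => //.
- by move=> y _; rewrite lee_fin addr_ge0 ?sqr_ge0.
- exact/measurable_EFinP.
- by apply: measurableT_comp => //; exact/measurable_EFinP.
- by move=> y _; rewrite /= lee_fin ler_norm.
Qed.

(** The map [z / (1 + |z|^2)] commutes with rotations, vanishes only at [0] and is
   bounded: it turns an eigenfunction into one that is square integrable for
   every probability measure. *)
Definition shrink (z : R[i]) : R[i] :=
  z * ((1 + `|complex.Re z ^+ 2 + complex.Im z ^+ 2|)^-1)%:C.

Lemma shrink_le1 z : `|shrink z| <= 1%:C.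
Proof.
case: z => a b; rewrite /shrink normrM !normc_def /=.
have n0 : 0 <= a ^+ 2 + b ^+ 2 by rewrite addr_ge0 ?sqr_ge0.
set n := a ^+ 2 + b ^+ 2 in n0 *.
rewrite expr0n addr0 sqrtr_sqr -rmorphM lecR /= (ger0_norm n0).
have n1 : 0 < 1 + n by lra.
rewrite ger0_norm ?invr_ge0 ?(ltW n1)// ler_pdivrMr// mul1r.
by have := sqr_sqrtr n0; have := sqrtr_ge0 n; nra.
Qed.

Lemma shrink_eq0 z : (shrink z == 0) = (z == 0).
Proof.
rewrite /shrink mulf_eq0 orb_idr// => /eqP h; exfalso; move: h => [] /eqP.
by rewrite invr_eq0 gt_eqF// ltr_wpDr.
Qed.

Lemma shrink_expi t z : shrink (expi t * z) = expi t * shrink z.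
Proof.
have sqE : complex.Re (expi t * z) ^+ 2 + complex.Im (expi t * z) ^+ 2 =
    complex.Re z ^+ 2 + complex.Im z ^+ 2.
  by apply: complexI; rewrite !add_Re2_Im2 normrM norm_expi mul1r.
by rewrite /shrink sqE mulrA.
Qed.

Lemma cmeasurable_shrink (g : X -> R[i]) :
  cmeasurable g -> cmeasurable (shrink \o g).
Proof.
move=> mg; apply: (@cmeasurableM _ X _ g) => //; apply: cmeasurable_real.
have [mg1 mg2] := mg.
have cinv : continuous (fun t : R => (1 + `|t|)^-1).
  move=> t; apply: (@continuousV _ _ (fun t : R => 1 + `|t|)).
    by rewrite gt_eqF// ltr_wpDr.
  by apply: cvgD; [exact: cvg_cst|exact: norm_continuous].
have mn : measurable_fun [set: X]
    (fun y => complex.Re (g y) ^+ 2 + complex.Im (g y) ^+ 2).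
  apply: (@measurable_funD _ X R setT (fun y => complex.Re (g y) ^+ 2)
    (fun y => complex.Im (g y) ^+ 2)); exact: measurable_funX.
exact: (measurableT_comp (continuous_measurable_fun cinv) mn).
Qed.

Lemma spectrum_bounded_eigenfunction (mu : probability X R) alpha :
  spectrum mu alpha -> exists g : X -> R[i],
    [/\ cmeasurable g, forall y, `|g y| <= 1%:C, ~ {ae mu, forall y, g y = 0}
      & {ae mu, forall y, g (T y) = expi alpha * g y}].
Proof.
move=> [_ [g [[mg1 mg2 _] g0 gT]]]; exists (shrink \o g); split.
- exact: cmeasurable_shrink.
- by move=> y; exact: shrink_le1.
- apply: contra_not g0; apply: filterS => y /= /eqP.
  by rewrite shrink_eq0 => /eqP.
- by apply: filterS gT => y /= ->; exact: shrink_expi.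
Qed.

(** The function [h] is [1/r] times the sum of its projections
   [g k = \sum_(j < r) e(- j (alpha + k) / r) h (T^j y)] for [k < r], and each
   [g k] is zero or an eigenfunction of the shift; they do not all vanish. *)
Lemma spectrum_root (mu : probability X R) (alpha : R) (r : nat) (h : X -> R[i]) :
  (0 < r)%N -> 0 <= alpha < 1 -> cmeasurable h -> (forall y, `|h y| <= 1%:C) ->
  ~ {ae mu, forall y, h y = 0} ->
  {ae mu, forall y, h (iter r T y) = expi alpha * h y} ->
  exists2 k : nat, (k < r)%N & spectrum mu ((alpha + k%:R) / r%:R).
Proof.
move=> r0 /andP[a0 a1] mh h1 hn0 hT.
have rR : 0 < r%:R :> R by rewrite ltr0n.
pose beta k := (alpha + k%:R) / r%:R.
pose g k y := \sum_(j < r) expi (- (j%:R * beta k)) * h (iter j T y).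
have gsum y : \sum_(k < r) g k y = r%:R * h y.
  rewrite exchange_big /=.
  transitivity (\sum_(j < r) expi (- (j%:R * (alpha / r%:R))) * h (iter j T y) *
     (if j == 0%N :> nat then r%:R else 0)).
    apply: eq_bigr => j _; rewrite -sum_expi// mulr_sumr; apply: eq_bigr => k _.
    rewrite mulrAC -expiD; congr (expi _ * _).
    by rewrite /beta; field; rewrite lt0r_neq0.
  case: r r0 {hT rR beta g} => // r _; rewrite big_ord_recl big1 => [|j _].
    by rewrite addr0 mul0r oppr0 expi0 mul1r mulrC.
  by rewrite mulr0.
have [k nk] : exists k : 'I_r, ~ {ae mu, forall y, g k y = 0}.
  apply: contrapT => /forallNP allk; apply: hn0.
  have : {ae mu, forall y, forall k : 'I_r, g k y = 0}.
    have aek n : {ae mu, forall y, (n < r)%N -> g n y = 0}.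
      have [nr|rn] := ltnP n r; last by apply: aeW.
      by have /contrapT := allk (Ordinal nr); apply: filterS => y.
    by apply: filterS (ae_foralln aek) => y gy k; exact: gy.
  apply: filterS => y gy; have := gsum y; rewrite big1 => [/esym/eqP|k _]; last exact: gy.
  by rewrite mulf_eq0 pnatr_eq0 gtn_eqF//= => /eqP.
exists k => //; apply: (@spectrum_intro _ _ r%:R (g k)) => //.
- rewrite divr_ge0 ?addr_ge0 ?ler0n//= ltr_pdivrMr// mul1r.
  by rewrite (@lt_le_trans _ _ (k.+1%:R))// ?ler_nat// -natr1 addrC ltrD2l.
- apply: cmeasurable_sum => j; apply: cmeasurableM; first exact: cmeasurable_cst.
  exact: cmeasurable_comp (iter_left_shift_borel j) mh.
- move=> y; apply: le_trans (ler_norm_sum _ _ _) _.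
  rewrite rmorph_nat -[leRHS]mulr1 mulr_natl -[r in leRHS]card_ord -sumr_const.
  by apply: ler_sum => j _; rewrite normrM norm_expi mul1r; exact: h1.
apply: filterS hT => y hTy.
have br : r%:R * beta k = alpha + k%:R by rewrite /beta mulrC divfK// lt0r_neq0.
rewrite mulr_sumr.
transitivity (\sum_(1 <= j < r.+1) expi (beta k) * (expi (- (j%:R * beta k)) * h (iter j T y))).
  rewrite big_add1 big_mkord; apply: eq_bigr => j _.
  rewrite mulrA -expiD -iterSr; congr (expi _ * _).
  by rewrite -natr1; ring.
rewrite -(big_mkord xpredT (fun j => expi (beta k) * (expi (- (j%:R * beta k)) * h (iter j T y)))).
rewrite [RHS]big_ltn// big_nat_recr//= addrC; congr (_ + _).
rewrite hTy br mul0r oppr0 expi0 mul1r; congr (_ * _).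
have : expi (- (alpha + k%:R)) * expi alpha = 1 :> R[i].
  have : expi (- (alpha + k%:R) + alpha) * expi k%:R = 1 :> R[i].
    by rewrite -expiD (_ : _ + _ = 0) ?expi0//; ring.
  by rewrite expi_nat mulr1 expiD.
by rewrite mulrA => ->; rewrite mul1r.
Qed.

(** An eigenfunction [g] of [mu] satisfies its equation [mu]-almost everywhere, and
   [mu] may ignore much of the image of [nu] under [S].  Cutting [g] off on the
   exhausting null set [B] repairs this: off [B] the two measures have the same
   null sets, and invariance of both makes [B] invariant almost everywhere for
   the image of [nu].  Composed with [S], the result is an eigenfunction of the
   [r]-th power of the shift for [nu]. *)
Lemma spectrum_lift (mu nu : probability X R) (S : X -> X) (alpha : R) (r : nat) :
  (0 < r)%N -> measurable_fun setT S -> (forall y, S (iter r T y) = T (S y)) ->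
  shift_invariant mu -> shift_invariant nu ->
  (forall A, measurable A -> nu (S @^-1` A) = 0%E -> mu A = 0%E) ->
  spectrum mu alpha ->
  exists2 k : nat, (k < r)%N & spectrum nu ((alpha + k%:R) / r%:R).
Proof.
move=> r0 mS ST inv_mu inv_nu mu_nu /[dup] -[a01 _].
move=> /spectrum_bounded_eigenfunction[g [mg g1 gn0 [N [mN N0 gN]]]].
have [B [mB B0 Bmax]] := null_set_exhaustion mu nu mS.
have mTB : measurable (T @^-1` B) := borel_preimage left_shift_borel mB.
pose g0 y := g y * (\1_(~` B) y)%:C.
have mg0 : cmeasurable g0.
  apply: cmeasurableM => //; apply: cmeasurable_real.
  by apply: measurable_indic; exact: measurableC.
have g0B y : B y -> g0 y = 0.
  by move=> By; rewrite /g0 indicE memNset ?mulr0//; exact.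
have g0nB y : ~ B y -> g0 y = g y.
  by move=> nBy; rewrite /g0 indicE mem_set ?mulr1.
apply: (@spectrum_root nu alpha r (g0 \o S)) => //.
- exact: cmeasurable_comp mS mg0.
- move=> y /=; have [By|nBy] := pselect (B (S y)); last by rewrite g0nB.
  by rewrite g0B// normr0 lecR ler01.
- move=> [Z [mZ Z0 gZ]]; apply: gn0.
  have mP : measurable (~` [set y | g0 y = 0]).
    by apply: measurableC; exact: cmeasurable_eq0.
  have P0 : mu (~` [set y | g0 y = 0]) = 0%E.
    apply: mu_nu => //; apply/negligibleP; first exact: borel_preimage.
    by exists Z; split=> // y; exact: gZ.
  apply: (@negligibleS _ _ _ _ (~` [set y | g0 y = 0] `|` B)).
    move=> y /= gy; have [By|nBy] := pselect (B y); [by right|left].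
    by rewrite /= g0nB.
  by apply: negligibleU; exact/negligibleP.
pose D1 := T @^-1` B `\` B; pose D2 := B `\` T @^-1` B.
have D10 : nu (S @^-1` D1) = 0%E.
  apply: (Bmax (T @^-1` B)) => //; by rewrite inv_mu.
have mSE E : measurable E -> measurable (S @^-1` E) by exact: borel_preimage.
have nuTB : nu (S @^-1` (T @^-1` B)) = nu (S @^-1` B).
  rewrite -(shift_invariant_iter r inv_nu (mSE B mB)); congr (nu _).
  by apply/seteqP; split=> y /=; rewrite ST.
have D20 : nu (S @^-1` D2) = 0%E.
  pose c := nu (S @^-1` (T @^-1` B) `&` S @^-1` B).
  have c_fin : c \is a fin_num.
    by rewrite fin_num_measure//; apply: measurableI; exact: mSE.
  have e1 : nu (S @^-1` (T @^-1` B)) = (nu (S @^-1` D1) + c)%E.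
    exact: measureDI (mSE _ mTB) (mSE _ mB).
  have e2 : nu (S @^-1` B) = (nu (S @^-1` D2) + c)%E.
    rewrite /c setIC; exact: measureDI (mSE _ mB) (mSE _ mTB).
  move: e2; rewrite -nuTB e1 D10 add0e => /(congr1 (fun z => z - c)%E).
  by rewrite addeK// subee.
have N'0 : nu (S @^-1` (N `\` B)) = 0%E by exact: Bmax.
exists (S @^-1` D1 `|` S @^-1` D2 `|` S @^-1` (N `\` B)); split.
- by rewrite -!preimage_setU; apply: borel_preimage => //; do !apply: measurableU => //;
    exact: measurableD.
- have neg E : measurable E -> nu (S @^-1` E) = 0%E -> nu.-negligible (S @^-1` E).
    by move=> mE E0; apply/negligibleP => //; exact: mSE.
  apply/negligibleP; first by do !apply: measurableU; apply: mSE; exact: measurableD.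
  by do !apply: negligibleU; apply: neg => //; exact: measurableD.
move=> y /= h; rewrite ST in h.
have [By|nBy] := pselect (B (S y)).
  left; right; split=> // BTy; apply: h.
  by rewrite !g0B// mulr0.
have [BTy|nBTy] := pselect (B (T (S y))); first by left; left.
right; split=> //; apply: gN => /= gTy; apply: h.
by rewrite !g0nB.
Qed.

(** Under an ergodic measure an eigenfunction vanishes almost nowhere, so it
   remains non-zero for every absolutely continuous measure. *)
Lemma ergodic_spectrum (mu nu : probability X R) (alpha : R) :
  ergodic mu -> shift_invariant mu ->
  (forall A, measurable A -> mu A = 0%E -> nu A = 0%E) ->
  spectrum mu alpha -> spectrum nu alpha.
Proof.
move=> erg inv nu_mu /[dup] -[a01 _].
move=> /spectrum_bounded_eigenfunction[g [mg g1 gn0 gT]].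
have dom_ae P : {ae mu, forall y, P y} -> {ae nu, forall y, P y}.
  by move=> [A [mA A0 PA]]; exists A; split=> //; exact: nu_mu.
apply: (@spectrum_intro nu alpha 1 g) => //; last exact: dom_ae.
pose P := [set y | g y = 0].
have mP : measurable P by exact: cmeasurable_eq0.
(* The zero set of [g] is invariant almost everywhere only; the points whose
   orbit eventually stays in it form a strictly invariant set. *)
pose A := \bigcup_n \bigcap_(m in [set m | (n <= m)%N]) (iter m T @^-1` P).
have mA : measurable A.
  apply: bigcupT_measurable => n; apply: bigcap_measurable => [|m _]; first by exists n => /=.
  exact: borel_preimage (iter_left_shift_borel m) mP.
have TA : T @^-1` A = A.
  apply/seteqP; split=> y [n _ Py].
    exists n.+1 => // -[//|m] /= nm; have := Py m nm.
    by rewrite /= -iterSr.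
  exists n => // m /= nm; have := Py m.+1 (leqW nm).
  by rewrite /= -iterSr.
have [N [mN N0 PN]] : {ae mu, forall y, forall m, g (iter m T y) = 0 <-> g y = 0}.
  have stepP : {ae mu, forall y, forall m, g (T (iter m T y)) = 0 <-> g (iter m T y) = 0}.
    apply: ae_foralln => m.
    have := negligible_iter m inv gT; apply: negligibleS => y /= h gTy; apply: h.
    rewrite gTy; split=> [/eqP|->]; last by rewrite mulr0.
    by rewrite mulf_eq0 (negbTE (expi_neq0 _)) => /eqP.
  apply: filterS stepP => y gy; elim=> [|m IHm] //=.
  by rewrite gy.
have AP y : ~ N y -> A y <-> P y.
  move=> nNy; have {}PN m : g (iter m T y) = 0 <-> g y = 0.
    by apply: contrapT => h; apply: nNy; apply: PN => /(_ m).
  split=> [[n _ /(_ n (leqnn n))]|Py]; first by move/PN.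
  by exists 0%N => // m _; apply/PN.
have [A0|A1] := erg A mA TA.
  move=> gn; have : {ae nu, forall y, g y <> 0}.
    apply: dom_ae; apply: (@negligibleS _ _ _ _ (A `|` N)).
      move=> y /= /contrapT Py; have [Ny|nNy] := pselect (N y); [by right|left].
      exact/AP.
    by apply: negligibleU; exact/negligibleP.
  move=> gn'; have : nu.-negligible [set: X].
    apply: negligibleS (negligibleU gn gn') => y _.
    by have [gy|gy] := pselect (g y = 0); [right; exact|left].
  move/negligibleP => /(_ measurableT) nuT; have := probability_setT nu.
  by rewrite nuT => -[] /esym/eqP; rewrite oner_eq0.
exfalso; apply: gn0; apply: (@negligibleS _ _ _ _ (~` A `|` N)).
  move=> y /= gy; have [Ny|nNy] := pselect (N y); [by right|left].
  by move=> /(AP _ nNy).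
apply: negligibleU; last exact/negligibleP.
apply/negligibleP; first exact: measurableC.
by have := probability_setC mu mA; rewrite A1 subee.
Qed.

End Spectrum.

(** * Weighted averages *)
Section WeightedAverages.
Variable R : realType.
Implicit Types (w a b e : nat -> R) (N : nat).

Definition total w N := \sum_(0 <= i < N) w i.

(** The index [i] stands for the integer [i + 1]: the weight [1] gives Cesaro
   averages, the weight [1 / (i + 1)] logarithmic ones. *)
Definition average w a N := (total w N)^-1 * \sum_(0 <= i < N) w i * a i.

Definition weight w :=
  [/\ forall i, 0 <= w i, forall i, w i.+1 <= w i & total w @ \oo --> +oo].

Lemma total_ge0 w N : weight w -> 0 <= total w N.
Proof. by move=> [w0 _ _]; apply: sumr_ge0 => i _; exact: w0. Qed.

Lemma averageB w a b N : average w (fun i => a i - b i) N = average w a N - average w b N.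
Proof.
rewrite /average -mulrBr -sumrB; congr (_ * _).
by apply: eq_bigr => i _; rewrite mulrBr.
Qed.

Lemma ler_norm_weighted_sum w a (c : R) m N : (forall i, 0 <= w i) ->
  (forall i, (m <= i)%N -> `|a i| <= c) ->
  `|\sum_(m <= i < N) w i * a i| <= c * \sum_(m <= i < N) w i.
Proof.
move=> w0 ac; apply: le_trans (ler_norm_sum _ _ _) _; rewrite mulr_sumr.
rewrite big_nat [leRHS]big_nat; apply: ler_sum => i /andP[mi _].
by rewrite normrM (ger0_norm (w0 i)) mulrC ler_wpM2r ?ac.
Qed.

Lemma norm_average_le w a (c : R) N : weight w -> 0 <= c -> (forall i, `|a i| <= c) ->
  `|average w a N| <= c.
Proof.
move=> wt c0 ac; have [w0 _ _] := wt; rewrite /average normrM.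
rewrite ger0_norm ?invr_ge0 ?total_ge0//.
have [tN|tN] := eqVneq (total w N) 0; first by rewrite tN invr0 mul0r.
rewrite ler_pdivrMl ?lt0r ?tN ?total_ge0// mulrC.
exact: ler_norm_weighted_sum.
Qed.

Lemma total_cvg_comp w (N_ : nat -> nat) : weight w -> N_ @ \oo --> \oo ->
  (fun k => total w (N_ k)) @ \oo --> +oo.
Proof. by move=> [_ _ wd] Noo; exact: cvg_comp Noo wd. Qed.

Lemma cvg0_over_infinity (V u : nat -> R) (c : R) : V @ \oo --> +oo ->
  (\forall k \near \oo, `|u k| <= c / V k) -> u @ \oo --> 0.
Proof.
move=> /cvgryPge Voo uV; apply/cvgrPdist_le => e e0; near=> k.
rewrite sub0r normrN.
have Vk : Num.max 1 (c / e) <= V k by near: k; exact: Voo.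
have V0 : 0 < V k by apply: lt_le_trans Vk; rewrite lt_max ltr01.
apply: (@le_trans _ _ (c / V k)); first by near: k.
rewrite ler_pdivrMr// mulrC -ler_pdivrMr//.
by apply: le_trans Vk; rewrite le_max lexx orbT.
Unshelve. all: by end_near. Qed.

Lemma average_cvg0 w e (N_ : nat -> nat) : weight w -> N_ @ \oo --> \oo ->
  e @ \oo --> 0 -> (fun k => average w e (N_ k)) @ \oo --> 0.
Proof.
move=> wt Noo e0; suff : average w e @ \oo --> 0 by exact: cvg_comp Noo.
have [w0 _ woo] := wt.
apply/cvgrPdist_le => eps eps0.
have eps2 : 0 < eps / 2 by rewrite divr_gt0.
have /cvgrPdist_le/(_ _ eps2)[m _ em] := e0.
pose B := `|\sum_(0 <= i < m) w i * e i|.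
near=> N; rewrite sub0r normrN.
have tN : 1 + B / (eps / 2) <= total w N.
  by near: N; move/cvgryPge : woo; exact.
have t0 : 0 < total w N.
  apply: lt_le_trans tN; apply: (lt_le_trans ltr01); rewrite lerDl.
  by rewrite divr_ge0 ?normr_ge0// ltW.
have mN : (m <= N)%N by near: N; exists m.
rewrite /average normrM gtr0_norm ?invr_gt0// ler_pdivrMl//.
rewrite (@big_cat_nat _ _ _ m)//=; apply: le_trans (ler_normD _ _) _.
rewrite [eps]splitr mulrDr; apply: lerD.
  rewrite -ler_pdivrMr// -/B; apply: le_trans tN; by rewrite lerDr.
apply: le_trans (@ler_norm_weighted_sum w e (eps / 2) m N w0 _) _.
  by move=> i /em /=; rewrite sub0r normrN.
rewrite mulrC ler_wpM2r ?(ltW eps2)//.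
by rewrite /total (@big_cat_nat _ _ _ m 0%N N)//= lerDr sumr_ge0.
Unshelve. all: by end_near. Qed.

(** Summation by parts: since [w] decreases, the difference of the sums is bounded
   while the total weight tends to infinity. *)
Lemma average_shift_cvg0 w a (c : R) (N_ : nat -> nat) : weight w -> N_ @ \oo --> \oo ->
  (forall i, `|a i| <= c) ->
  (fun k => average w (fun i => a i.+1) (N_ k) - average w a (N_ k)) @ \oo --> 0.
Proof.
move=> wt Noo ac; have [w0 wd _] := wt.
have c0 : 0 <= c by exact: le_trans (ac 0%N).
apply: (@cvg0_over_infinity (fun k => total w (N_ k)) _ (2 * c * w 0%N)).
  exact: total_cvg_comp.
apply: nearW => k; move: (N_ k) => N.
rewrite /average -mulrBr normrM ger0_norm ?invr_ge0 ?total_ge0// mulrC.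
apply: ler_wpM2r; first by rewrite invr_ge0 total_ge0.
suff : `|\sum_(0 <= i < N) w i * a i.+1 - \sum_(0 <= i < N) w i * a i - w N * a N|
    <= c * w 0%N + c * (w 0%N - w N) .
  have := ler_normD (\sum_(0 <= i < N) w i * a i.+1 - \sum_(0 <= i < N) w i * a i
    - w N * a N) (w N * a N); rewrite subrK.
  have : `|w N * a N| <= c * w N.
    by rewrite normrM ger0_norm// mulrC ler_wpM2r.
  lra.
elim: N => [|N IHN].
  rewrite !big_nil subr0 sub0r normrN normrM (ger0_norm (w0 _)) subrr mulr0 addr0.
  by rewrite mulrC ler_wpM2r.
rewrite !big_nat_recr//=.
set S1 := \sum_(_ <= _ < _) _ in IHN *; set S2 := \sum_(_ <= _ < _) w _ * a _ in IHN *.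
have -> : S1 + w N * a N.+1 - (S2 + w N * a N) - w N.+1 * a N.+1 =
  (S1 - S2 - w N * a N) + (w N - w N.+1) * a N.+1 by ring.
apply: le_trans (ler_normD _ _) _.
have : `|(w N - w N.+1) * a N.+1| <= c * (w N - w N.+1).
  by rewrite normrM ger0_norm ?subr_ge0// mulrC ler_wpM2r ?subr_ge0.
lra.
Qed.

(** The difference is of the order of the discarded weight divided by the total
   weight. *)
Lemma average_truncate_cvg0 w a (c d : R) (M_ N_ : nat -> nat) :
  weight w -> N_ @ \oo --> \oo -> (forall i, `|a i| <= c) ->
  (forall k, (M_ k <= N_ k)%N) ->
  (forall k, total w (N_ k) - total w (M_ k) <= d) ->
  (fun k => average w a (M_ k) - average w a (N_ k)) @ \oo --> 0.
Proof.
move=> wt Noo ac MN tMN; have [w0 _ _] := wt.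
have c0 : 0 <= c by exact: le_trans (ac 0%N).
apply: (@cvg0_over_infinity (fun k => total w (N_ k)) _ (2 * c * d)).
  exact: total_cvg_comp.
have /cvgryPge/(_ 1) tN1 := total_cvg_comp wt Noo.
near=> k; have t0 : 0 < total w (N_ k).
  by apply: (@lt_le_trans _ _ 1) => //; near: k.
have tE : total w (N_ k) - total w (M_ k) = \sum_(M_ k <= i < N_ k) w i.
  by rewrite /total (@big_cat_nat _ _ _ (M_ k) 0%N (N_ k))//= addrAC subrr add0r.
have rest : `|\sum_(M_ k <= i < N_ k) w i * a i| <= c * (total w (N_ k) - total w (M_ k)).
  by rewrite tE; exact: ler_norm_weighted_sum.
have main : `|average w a (M_ k)| <= c by exact: norm_average_le.
have d_ge := tMN k.
have diff0 : 0 <= total w (N_ k) - total w (M_ k) by rewrite tE sumr_ge0.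
rewrite ler_pdivlMr// -[X in _ * X]gtr0_norm// -normrM mulrBl.
have -> : average w a (N_ k) * total w (N_ k) =
    average w a (M_ k) * total w (M_ k) + \sum_(M_ k <= i < N_ k) w i * a i.
  rewrite /average mulrAC mulVf ?gt_eqF// mul1r (@big_cat_nat _ _ _ (M_ k))//=.
  congr (_ + _); have [tM|tM] := eqVneq (total w (M_ k)) 0; last by rewrite mulrAC mulVf// mul1r.
  rewrite tM mulr0 big_nat big1// => i /andP[_ iM].
  suff -> : w i = 0 by rewrite mul0r.
  apply/eqP; rewrite eq_le w0 andbT -tM /total (bigD1_seq i)//= ?mem_index_iota ?iota_uniq//.
  by rewrite lerDl sumr_ge0.
set A := average w a (M_ k) in main *; set t := total w (N_ k) in t0 diff0 d_ge rest *.
set s := total w (M_ k) in diff0 d_ge rest *; set r := \sum_(_ <= _ < _) _ in rest *.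
have -> : A * t - (A * s + r) = A * (t - s) - r by ring.
apply: le_trans (ler_normB _ _) _; rewrite normrM (ger0_norm diff0).
have : `|A| * (t - s) <= c * (t - s) by rewrite ler_wpM2r.
have : c * (t - s) <= c * d by rewrite ler_wpM2l.
lra.
Unshelve. all: by end_near. Qed.

Lemma sum_multiples_le (F : nat -> R) (r N M : nat) :
  (forall m, 0 <= F m) -> (0 < r)%N -> (r * N <= M)%N ->
  \sum_(0 <= i < N) F (r * i.+1).-1 <= \sum_(0 <= m < M) F m.
Proof.
move=> F0 r0; elim: N M => [|N IHN] M rNM; first by rewrite big_nil sumr_ge0.
have rN0 : (0 < r * N.+1)%N by rewrite muln_gt0 r0.
rewrite big_nat_recr//= (@big_cat_nat _ _ _ (r * N.+1) 0%N M)//=.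
rewrite -[leLHS]addr0 lerD ?sumr_ge0//.
rewrite -{2}(prednK rN0) big_nat_recr//= lerD2r; apply: IHN.
by rewrite -ltnS prednK// ltn_pmul2l.
Qed.

(** For a non-negative sequence, keeping only the multiples of [r] loses mass;
   [D] compares the weights of [n] and [r n], and [C] the normalizations. *)
Lemma average_dilate_le w a (D C : R) (r M N : nat) :
  weight w -> (forall i, 0 <= a i) -> (0 < r)%N -> (r * N <= M)%N ->
  (forall i, w i <= D * w (r * i.+1).-1) -> 0 <= D ->
  0 < total w N -> total w M <= C * total w N ->
  average w (fun i => a (r * i.+1).-1) N <= D * C * average w a M.
Proof.
move=> wt a0 r0 rNM wD D0 tN tMN; have [w0 _ _] := wt.
have wa0 i : 0 <= w i * a i by rewrite mulr_ge0.
have sums : \sum_(0 <= i < N) w i * a (r * i.+1).-1 <= D * \sum_(0 <= i < M) w i * a i.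
  apply: (@le_trans _ _ (D * \sum_(0 <= i < N) w (r * i.+1).-1 * a (r * i.+1).-1)).
    by rewrite mulr_sumr; apply: ler_sum => i _; rewrite mulrA ler_wpM2r.
  by apply: ler_wpM2l => //; exact: (@sum_multiples_le (fun m => w m * a m) r N M).
rewrite /average.
have tM : 0 <= total w M by exact: total_ge0.
have [tM0|tM0] := eqVneq (total w M) 0.
  have NM : (N <= M)%N by apply: leq_trans rNM; rewrite leq_pmull.
  suff : total w N <= total w M by rewrite tM0 leNgt tN.
  by rewrite /total (@big_cat_nat _ _ _ N 0%N M)//= lerDl sumr_ge0.
have {}tM : 0 < total w M by rewrite lt0r tM0.
rewrite ler_pdivrMl//; apply: le_trans sums _.
have -> : total w N * (D * C * ((total w M)^-1 * \sum_(0 <= i < M) w i * a i)) =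
    D * (\sum_(0 <= i < M) w i * a i) * ((C * total w N) / total w M) by ring.
rewrite ler_peMr ?mulr_ge0 ?sumr_ge0//.
by rewrite ler_pdivlMr// mul1r.
Qed.

End WeightedAverages.

(** * Limits of averages along an orbit *)
Section OrbitAverages.
Variable R : realType.
Local Notation X := (shift_space R).
Local Notation T := (@left_shift R).
Implicit Types (x : X) (w : nat -> R) (mu nu : probability X R).

Lemma Rintegral_finite_sum (m : nat -> {measure set X -> \bar R}) (k : nat -> R)
    (p : nat -> X) (c : {nonneg R}) (F : X -> R) (N : nat) :
  (forall i, 0 <= k i) ->
  (forall i (f : X -> \bar R), measurable_fun setT f -> (forall y, 0 <= f y)%E ->
    \int[m i]_y f y = (k i)%:E * f (p i))%E ->
  continuous F ->
  \int[mscale c (msum m N)]_y F y = c%:num * \sum_(0 <= i < N) k i * F (p i).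
Proof.
move=> k0 mE cF.
have ge0_sum (f : X -> \bar R) : measurable_fun setT f -> (forall y, 0 <= f y)%E ->
    (\int[mscale c (msum m N)]_y f y = c%:num%:E * \sum_(i < N) (k i)%:E * f (p i))%E.
  move=> mf f0; rewrite ge0_integral_mscale//; congr (_ * _)%E.
  by rewrite ge0_integral_measure_sum//; apply: eq_bigr => i _; rewrite mE.
have mF : measurable_fun [set: X] (EFin \o F).
  by apply/measurable_EFinP; exact: continuous_borel_real.
rewrite /Rintegral integralE !ge0_sum//; last 2 first.
- exact: measurable_funeneg.
- exact: measurable_funepos.
have pos y : ((EFin \o F)^\+ y)%E = (Num.max (F y) 0)%:E by rewrite funeposE/= EFin_max.
have neg y : ((EFin \o F)^\- y)%E = (Num.max (- F y) 0)%:E by rewrite funenegE/= EFin_max.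
under eq_bigr do rewrite pos -EFinM.
under [X in (_ - _ * X)%E]eq_bigr do rewrite neg -EFinM.
rewrite !sumEFin -!EFinM -EFinB/= -mulrBr -sumrB big_mkord; congr (_ * _).
apply: eq_bigr => i _; rewrite -mulrBr; congr (_ * _).
have /orP[Fp|Fp] := le_total 0 (F (p i)).
  by rewrite (max_l Fp) (@max_r _ _ (- F (p i)) 0) ?oppr_le0// subr0.
by rewrite (max_r Fp) (@max_l _ _ (- F (p i)) 0) ?oppr_ge0// sub0r opprK.
Qed.

Definition limit_average w x (N_ : nat -> nat) mu := forall F : X -> R, continuous F ->
  (fun k => average w (fun i => F (iter i.+1 T x)) (N_ k)) @ \oo --> \int[mu]_y F y.

Lemma cesaro_limit x (N_ : nat -> nat) mu :
  weak_star_cvg (fun k => cesaro_avg x (N_ k)) mu <-> limit_average (fun=> 1) x N_ mu.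
Proof.
suff E F N : continuous F -> \int[cesaro_avg x N]_y F y =
    average (fun=> 1) (fun i => F (iter i.+1 T x)) N.
  have EN F : continuous F -> (fun k => \int[cesaro_avg x (N_ k)]_y F y) =
      (fun k => average (fun=> 1) (fun i => F (iter i.+1 T x)) (N_ k)).
    by move=> cF; apply: funext => k; exact: E.
  split=> lim F cF; first by rewrite -EN//; exact: lim.
  by have := lim F cF; rewrite -EN.
move=> cF; rewrite /cesaro_avg (@Rintegral_finite_sum _ (fun=> 1) (fun i => iter i.+1 T x))//=.
  by rewrite /average /total sumr_const_nat subn0.
by move=> i f mf f0; rewrite integral_dirac// diracT.
Qed.

Lemma log_limit x (N_ : nat -> nat) mu :
  weak_star_cvg (fun k => log_avg x (N_ k)) mu <->
  limit_average (fun i => i.+1%:R^-1) x N_ mu.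
Proof.
suff E F N : continuous F -> \int[log_avg x N]_y F y =
    average (fun i => i.+1%:R^-1) (fun i => F (iter i.+1 T x)) N.
  have EN F : continuous F -> (fun k => \int[log_avg x (N_ k)]_y F y) =
      (fun k => average (fun i => i.+1%:R^-1) (fun i => F (iter i.+1 T x)) (N_ k)).
    by move=> cF; apply: funext => k; exact: E.
  split=> lim F cF; first by rewrite -EN//; exact: lim.
  by have := lim F cF; rewrite -EN.
move=> cF; rewrite /log_avg (@Rintegral_finite_sum _ (fun i => i.+1%:R^-1) (fun i => iter i.+1 T x))//=.
  by rewrite /average /total big_add1.
by move=> i f mf f0; rewrite ge0_integral_mscale// integral_dirac// diracT mul1e.
Qed.

Lemma iter_bounded x (F : X -> R) : continuous F ->
  exists2 c, 0 <= c & forall i, `|F (iter i.+1 T x)| <= c.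
Proof. by move=> /continuous_bounded[c c0 Fc]; exists c. Qed.

(** Domination of [mu] by its image, applied to a set and to its complement. *)
Lemma limit_average_invariant w x (N_ : nat -> nat) mu : weight w -> N_ @ \oo --> \oo ->
  limit_average w x N_ mu -> shift_invariant mu.
Proof.
move=> wt Noo lim.
have int_shift F : continuous F -> \int[mu]_y F (T y) = \int[mu]_y F y.
  move=> cF; have cFT : continuous (F \o T).
    by move=> y; apply: continuous_comp; [exact: left_shift_continuous|exact: cF].
  have [c _ Fc] := iter_bounded x cF.
  apply/eqP; rewrite -subr_eq0; apply/eqP.
  apply: cvg_unique (average_shift_cvg0 wt Noo Fc) => //.
  exact: (cvgB (lim _ cFT) (lim _ cF)).
have le_shift A : measurable A -> (mu A <= mu (T @^-1` A))%E.
  move=> mA; rewrite -[leRHS]mul1e.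
  apply: (integral_domination (@left_shift_continuous R) ler01) => // F cF F0.
  by rewrite mul1r int_shift.
move=> A mA; apply/eqP; rewrite eq_le le_shift// andbT.
have mTA := borel_preimage (left_shift_borel (R:=R)) mA.
have := le_shift _ (measurableC mA); rewrite preimage_setC.
rewrite (probability_setC mu mA) (probability_setC mu mTA).
have fin B : measurable B -> mu B \is a fin_num by exact: fin_num_measure.
by rewrite -(fineK (fin _ mA)) -(fineK (fin _ mTA)) -!EFinB !lee_fin lerD2l lerN2.
Qed.

(** When [S (T^(r n) x)] shadows [T^n x], averages along [n <= N] are dominated by
   averages of [F \o S] along the multiples [r n <= M], hence by full averages. *)
Lemma limit_average_transfer w x (N_ M_ : nat -> nat) mu nu (S : X -> X) (r : nat) (D C : R) :
  weight w -> N_ @ \oo --> \oo -> continuous S -> (0 < r)%N -> 0 <= D -> 0 <= C ->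
  (forall F : X -> R, continuous F ->
    (fun i => F (iter i.+1 T x) - F (S (iter (r * i.+1) T x))) @ \oo --> 0) ->
  (forall i, w i <= D * w (r * i.+1).-1) ->
  (forall k, (r * N_ k <= M_ k)%N) ->
  (\forall k \near \oo, total w (M_ k) <= C * total w (N_ k)) ->
  limit_average w x N_ mu -> limit_average w x M_ nu ->
  forall A, measurable A -> (mu A <= (D * C)%:E * nu (S @^-1` A))%E.
Proof.
move=> wt Noo cS r0 D0 C0 close wD rNM tMN limN limM.
apply: (integral_domination cS); first exact: mulr_ge0.
move=> F cF F0.
have cFS : continuous (F \o S).
  by move=> y; apply: continuous_comp; [exact: cS|exact: cF].
pose b i := F (S (iter (r * i.+1) T x)).
have limb : (fun k => average w b (N_ k)) @ \oo --> \int[mu]_y F y.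
  have -> : (fun k => average w b (N_ k)) = (fun k =>
      average w (fun i => F (iter i.+1 T x)) (N_ k) -
      average w (fun i => F (iter i.+1 T x) - b i) (N_ k)).
    by apply: funext => k; rewrite averageB opprB addrC subrK.
  rewrite -[X in _ --> X]subr0.
  by apply: cvgB; [exact: limN|exact: average_cvg0 (close F cF)].
have limDC : (fun k => D * C * average w (fun i => F (S (iter i.+1 T x))) (M_ k)) @ \oo -->
    D * C * \int[nu]_y F (S y).
  by apply: cvgM; [exact: cvg_cst|exact: (limM _ cFS)].
apply: (ler_cvg_to limb limDC).
have /cvgryPge/(_ 1) tN1 := total_cvg_comp wt Noo.
near=> k; have t0 : 0 < total w (N_ k).
  by apply: (@lt_le_trans _ _ 1) => //; near: k.
have := @average_dilate_le _ w (fun i => F (S (iter i.+1 T x))) D C r (M_ k) (N_ k) wt.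
have -> : average w (fun i => F (S (iter (r * i.+1).-1.+1 T x))) (N_ k) = average w b (N_ k).
  rewrite /average; congr (_ * _); apply: eq_bigr => i _; rewrite /b prednK//.
  by rewrite muln_gt0 r0.
apply=> //; by near: k.
Unshelve. all: by end_near. Qed.

(** The two points agree at all positions above [- i], and [F] depends up to an
   error on a bounded window of positions. *)
Lemma dilate_asymptotic (f : nat -> unit_disc R) x (r : nat) (F : X -> R) :
  completely_multiplicative f -> extends x f -> (0 < r)%N -> disc_val (f r) <> 0 ->
  continuous F ->
  (fun i => F (iter i.+1 T x) - F (dilate (disc_val (f r)) r (iter (r * i.+1) T x)))
    @ \oo --> 0.
Proof.
move=> fM xf r0 fr0 cF; apply/cvgrPdist_lt => e e0.
have [n Fn] := @continuous_finite_coordinates R int absz (fun=> unit_disc R) F e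
  (@shift_space_compact R) cF e0.
near=> i; rewrite sub0r normrN; apply: Fn => k kn.
rewrite (dilate_multiplicative fM xf)//.
have ni : (n <= i)%N by near: i; exists n.
lia.
Unshelve. all: by end_near. Qed.

Lemma weight_one : weight (fun=> 1 : R).
Proof.
split=> //; apply/cvgryPge => A; near=> n.
rewrite /total sumr_const_nat subn0; near: n.
exact: nbhs_infty_ger.
Unshelve. all: by end_near. Qed.

Lemma weight_harmonic : weight (fun i => i.+1%:R^-1 : R).
Proof.
split=> [i|i|]; first by rewrite invr_ge0.
  by rewrite lef_pV2 ?posrE ?ltr0n// ler_nat.
have -> : total (fun i => i.+1%:R^-1 : R) = series (@harmonic R) by [].
apply: nondecreasing_dvgn_lt; last exact: dvg_harmonic.
by apply: nondecreasing_series => n _ _; exact: harmonic_ge0.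
Qed.

End OrbitAverages.

(** * Weak limits of averages exist *)
Section Subsequences.
Variable R : realType.

Lemma increasing_ge_id (j : nat -> nat) : {homo j : m n / (m < n)%N} ->
  forall n, (n <= j n)%N.
Proof. by move=> j_inc; elim=> // n IHn; apply: leq_ltn_trans IHn (j_inc _ _ _). Qed.

Lemma increasing_cvg_infty (j : nat -> nat) : {homo j : m n / (m < n)%N} ->
  j @ \oo --> \oo.
Proof.
move=> j_inc; apply/cvgnyPge => A; exists A => // n /= An.
exact: leq_trans An (increasing_ge_id j_inc n).
Qed.

Lemma compact_subsequence (Y : pseudoMetricType R) (A : set Y) (u : nat -> Y) :
  compact A -> (forall n, A (u n)) -> exists (j : nat -> nat) (l : Y),
    {homo j : m n / (m < n)%N} /\ (u \o j) @ \oo --> l.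
Proof.
move=> cA Au; have [l [_ ul]] : A `&` cluster (u @ \oo) !=set0.
  by apply: cA; exists 0%N => // n _; exact: Au.
have /choice[pick pickP] : forall mk : nat * nat, exists n,
    (mk.1 <= n)%N /\ ball l mk.2.+1%:R^-1 (u n).
  move=> [m k]; have := ul [set u n | n in [set n | (m <= n)%N]] (ball l k.+1%:R^-1).
  case.
  - by exists m => // n /= mn; exists n.
  - by apply: nbhsx_ballx; rewrite invr_gt0 ltr0n.
  - by move=> _ [[n /= mn <-] ln]; exists n.
pose fix j k := if k is k'.+1 then pick ((j k').+1, k) else pick (0%N, 0%N).
exists j, l; split.
  have jS k : (j k < j k.+1)%N by have [] := pickP ((j k).+1, k.+1).
  move=> m n; elim: n => // n IHn; rewrite ltnS leq_eqVlt => /predU1P[->|mn].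
    exact: jS.
  exact: ltn_trans (IHn mn) (jS n).
apply/cvg_ballP => e e0; near=> k.
have lk : ball l k.+1%:R^-1 (u (j k)).
  by case: (k) => [|k']; [have [] := pickP (0%N, 0%N)|have [] := pickP ((j k').+1, k'.+1)].
apply: le_ball lk; rewrite invf_ple ?posrE ?ltr0n//.
apply: (@le_trans _ _ k%:R); last by rewrite ler_nat.
by near: k; exact: nbhs_infty_ger.
Unshelve. all: by end_near. Qed.

Lemma power_subsequence (T : pseudoMetricType R) (I : countType) (A : set T)
    (u : nat -> I -> T) :
  compact A -> (forall n i, A (u n i)) -> exists (j : nat -> nat) (p : I -> T),
    {homo j : m n / (m < n)%N} /\ forall i, (fun k => u (j k) i) @ \oo --> p i.
Proof.
move=> cA Au.
have [|j [p [j_inc up]]] := @compact_subsequence (power T I)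
  [set q | forall i, A (q i)] u _ Au; first exact: (tychonoff (fun=> cA)).
exists j, p; split=> // i.
apply: (@cvg_comp _ _ _ (fun k => u (j k)) (fun q : {ptws I -> T} => q i)); first exact: up.
exact: (@proj_continuous I (fun=> T) i p).
Qed.

End Subsequences.

(** Prescribed frequencies [p] of the finite words are realized by a point of
   [0, 1) chosen uniformly: each word [s] receives an interval of length [p s],
   split between its two extensions, and [quantile t] reads the nested intervals
   that contain [t]. *)
Section Quantile.
Variables (R : realType) (p : seq bool -> R).
Hypothesis p_ge0 : forall s, 0 <= p s.
Hypothesis p_nil : p [::] = 1.
Hypothesis p_split : forall s, p s = p (rcons s false) + p (rcons s true).

(** The first [n] bits of [quantile t], and the left end of their interval. *)
Fixpoint descend (t : R) (n : nat) : seq bool * R :=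
  if n is n'.+1 then
    let: (s, l) := descend t n' in
    if t < l + p (rcons s false) then (rcons s false, l)
    else (rcons s true, l + p (rcons s false))
  else ([::], 0).

Definition quantile (t : R) : cantor_space := fun n =>
  ~~ (t < (descend t n).2 + p (rcons (descend t n).1 false)).

Lemma quantile_prefix t n : mkseq (quantile t) n = (descend t n).1.
Proof.
elim: n => // n IHn; rewrite mkseqS IHn /quantile /=.
by case: (descend t n) => s l /=; case: ifP.
Qed.

(** The claim is local to [0, 1): outside it the descent still runs, which adds to
   a cylinder a part that the uniform law ignores. *)
Lemma descend_interval s : exists l,
  [/\ 0 <= l, l + p s <= 1, measurable [set t | (descend t (size s)).1 = s],
      forall t, (descend t (size s)).1 = s -> (descend t (size s)).2 = l
    & forall t, 0 <= t < 1 -> (descend t (size s)).1 = s <-> l <= t < l + p s].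
Proof.
elim/last_ind: s => [|s b [l [l0 l1 ms low_s int_s]]].
  exists 0; rewrite add0r p_nil; split=> //.
  by rewrite (_ : [set t | _] = setT)//; apply/seteqP; split.
have p0 := p_ge0 (rcons s false); have p1 := p_ge0 (rcons s true).
have ps := p_split s.
have stepF t : (descend t (size s).+1).1 = rcons s false <->
    (descend t (size s)).1 = s /\ t < l + p (rcons s false).
  rewrite /=; have := low_s t; case: (descend t (size s)) => s' l' /= low.
  case: ifP => /= tl; split.
  - by move=> /rcons_inj[ss]; subst s'; rewrite -(low erefl).
  - by move=> [->].
  - by move=> /rcons_inj[].
  - by move=> [ss]; subst s'; rewrite -(low erefl) tl.
have stepT t : (descend t (size s).+1).1 = rcons s true <->
    (descend t (size s)).1 = s /\ ~~ (t < l + p (rcons s false)).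
  rewrite /=; have := low_s t; case: (descend t (size s)) => s' l' /= low.
  case: ifP => /= tl; split.
  - by move=> /rcons_inj[].
  - by move=> [ss]; subst s'; rewrite -(low erefl) tl.
  - by move=> /rcons_inj[ss]; subst s'; rewrite -(low erefl) tl.
  - by move=> [->].
rewrite size_rcons; case: b.
  exists (l + p (rcons s false)); split.
  - by rewrite addr_ge0.
  - by rewrite -addrA -ps.
  - rewrite (_ : [set t | _] = [set t | (descend t (size s)).1 = s] `&`
        [set` `[l + p (rcons s false), +oo[ ]).
      by apply: measurableI.
    by apply/seteqP; split=> t /=; rewrite in_itv/= andbT leNgt => /stepT.
  - move=> t /[dup] /stepT[ts tl] /=; have := low_s t ts; move: ts tl.
    by case: (descend t (size s)) => s' l' /= -> tl ->; rewrite (negbTE tl).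
  - move=> t t01; split.
      move=> /stepT[/int_s-/(_ t01)/andP[_ tu]]; rewrite -leNgt => tl.
      by rewrite tl -addrA -ps.
    move=> /andP[tl tu]; apply/stepT; rewrite -leNgt; split=> //.
    apply/int_s => //; rewrite ps addrA tu andbT; apply: le_trans tl.
    by rewrite lerDl.
exists l; split=> //.
- by apply: le_trans l1; rewrite lerD2l ps lerDl.
- rewrite (_ : [set t | _] = [set t | (descend t (size s)).1 = s] `&`
      [set` `]-oo, l + p (rcons s false)[ ]).
    by apply: measurableI.
  by apply/seteqP; split=> t /=; rewrite in_itv/= => /stepF.
- move=> t /[dup] /stepF[ts tl] /=; have := low_s t ts; move: ts tl.
  by case: (descend t (size s)) => s' l' /= -> tl ->; rewrite tl.
- move=> t t01; split.
    by move=> /stepF[/int_s-/(_ t01)/andP[-> _] ->].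
  move=> /andP[tl tu]; apply/stepF; split=> //; apply/int_s => //.
  rewrite tl /=; apply: lt_le_trans tu _.
  by rewrite lerD2l ps lerDl.
Qed.

Definition cylinder (s : seq bool) : set R := [set t | mkseq (quantile t) (size s) = s].

Lemma cylinderE s : cylinder s = [set t | (descend t (size s)).1 = s].
Proof. by apply/seteqP; split=> t /=; rewrite /cylinder/= quantile_prefix. Qed.

Lemma measurable_cylinder s : measurable (cylinder s).
Proof. by rewrite cylinderE; have [l []] := descend_interval s. Qed.

Local Notation unif := (uniform_prob (@ltr01 R)).

Lemma uniform_cylinder s : unif (cylinder s) = (p s)%:E.
Proof.
have [l [l0 l1 _ _ int_s]] := descend_interval s.
have unif_le (A : set R) : measurable A ->
    unif A = lebesgue_measure (A `&` `[0, 1]%classic).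
  move=> mA; rewrite /uniform_prob integral_uniform_pdf.
  rewrite (eq_integral (fun=> 1%E)); last first.
    by move=> t /set_mem[_]/=; rewrite in_itv/= /uniform_pdf => ->; rewrite subr0 invr1.
  by rewrite integral_cst ?mul1e//; exact: measurableI.
have mc := measurable_cylinder s.
rewrite unif_le//.
have -> : cylinder s `&` `[0, 1]%classic = `[l, l + p s[%classic `|` (cylinder s `&` [set 1]).
  apply/seteqP; split=> t.
    move=> [ts]; rewrite /= in_itv/= => /andP[t0 t1].
    have [tE|tn1] := eqVneq t 1; first by right.
    left; rewrite /= in_itv/=; apply/int_s; first by rewrite t0 lt_neqAle tn1.
    by move: ts; rewrite cylinderE.
  case=> [|[ts tE]]; last by split=> //; rewrite tE /= in_itv/= ler01 lexx.
  rewrite /= in_itv/= => /[dup] tI /andP[tl tu].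
  have t01 : 0 <= t < 1 by rewrite (le_trans l0 tl) (lt_le_trans tu l1).
  have /andP[t0 /ltW t1] := t01.
  by split; [rewrite cylinderE; exact/int_s|rewrite in_itv/= t0 t1].
have m1 : measurable (cylinder s `&` [set 1]) by exact: measurableI.
rewrite measureU0//; last first.
  apply/eqP; rewrite eq_le measure_ge0 andbT -(@lebesgue_measure_set1 R 1).
  by apply: le_measure; rewrite ?inE//; exact: subIsetr.
apply: etrans (lebesgue_measure_itv _) _; rewrite /= lte_fin.
case: ifPn => [_|]; first by rewrite -EFinB addrAC subrr add0r.
by rewrite ltrDl -leNgt => ps; congr EFin; apply/eqP; rewrite eq_le ps p_ge0.
Qed.

(** An open set of bit sequences is a countable union of cylinders. *)
Lemma quantile_borel (phi : cantor_space -> shift_space R) :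
  continuous phi -> measurable_fun [set: R] (phi \o quantile).
Proof.
move=> cphi; apply: (measurability (@open (shift_space R))) => //.
move=> _ [U oU <-]; rewrite setTI.
pose good s := [set t | cylinder s t /\
  forall b : cantor_space, mkseq b (size s) = s -> U (phi b)].
have mgood s : measurable (good s).
  have [h|h] := pselect (forall b : cantor_space, mkseq b (size s) = s -> U (phi b)).
    rewrite (_ : good s = cylinder s); first exact: measurable_cylinder.
    by apply/seteqP; split=> t; [case|split].
  rewrite (_ : good s = set0)//.
  by rewrite -subset0 => t [].
have -> : (phi \o quantile) @^-1` U = \bigcup_(s in [set: seq bool]) good s.
  apply/seteqP; split=> t /=; last first.
    by move=> [s _ [ts]]; exact.
  move=> Ut; have : nbhs (quantile t) (phi @^-1` U).
    by apply: cphi; exact: open_nbhs_nbhs.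
  move=> /(nbhs_finite_coordinates id)[n [C [nC CU Cn]]].
  exists (mkseq (quantile t) n) => //; split; first by rewrite /cylinder/= size_mkseq.
  move=> b; rewrite size_mkseq => bt; apply: CU; apply: Cn (nbhs_singleton nC) => i im.
  by rewrite -(nth_mkseq false (quantile t) im) -bt nth_mkseq.
have -> : \bigcup_(s in [set: seq bool]) good s =
    \bigcup_n (if unpickle n is Some s then good s else set0).
  apply/seteqP; split=> t [s _].
    by move=> ts; exists (pickle s) => //; rewrite pickleK.
  by case: (unpickle s) => // s' ts'; exists s'.
by apply: bigcupT_measurable => n; exact: mgood.
Qed.

End Quantile.

Section WeakLimits.
Variable R : realType.
Local Notation X := (shift_space R).
Local Notation T := (@left_shift R).
Local Notation unif := (uniform_prob (@ltr01 R)).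

Lemma average_sum (w : nat -> R) (I : finType) (c : I -> R) (a : I -> nat -> R) N :
  average w (fun i => \sum_s c s * a s i) N = \sum_s c s * average w (a s) N.
Proof.
rewrite /average.
under eq_bigr do rewrite mulr_sumr.
rewrite exchange_big /= mulr_sumr; apply: eq_bigr => s _.
rewrite mulrCA; congr (_ * _); rewrite mulr_sumr.
by apply: eq_bigr => i _; rewrite mulrCA.
Qed.

Lemma cvg_finite_sum (I : Type) (r : seq I) (u : I -> nat -> R) (l : I -> R) :
  (forall i, u i @ \oo --> l i) ->
  (fun k => \sum_(i <- r) u i k) @ \oo --> \sum_(i <- r) l i.
Proof.
move=> ul; elim: r => [|i r IHr].
  rewrite big_nil; under eq_fun do rewrite big_nil; exact: cvg_cst.
rewrite big_cons; under eq_fun do rewrite big_cons.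
exact: cvgD (ul i) IHr.
Qed.

(** This form makes averages and integrals of functions of the first [n] bits
   linear in the frequencies of words. *)
Lemma sum_prefix (n : nat) (c : seq bool -> R) (b : cantor_space) :
  \sum_(s : n.-tuple bool) c s * (mkseq b n == s)%:R = c (mkseq b n).
Proof.
have sz : size (mkseq b n) == n by rewrite size_mkseq.
rewrite (bigD1 (Tuple sz))//= eqxx mulr1 big1 ?addr0// => s sn.
rewrite (_ : (_ == _) = false) ?mulr0//; apply: contraNF sn => /eqP bs.
by apply/eqP/val_inj.
Qed.

(** Lift the orbit to bit sequences and extract a subsequence along which the
   frequency of every finite word converges.  The limits are consistent, so the
   quantile map realizes them; a continuous function is uniformly close to a
   function of finitely many bits, for which convergence is that of frequencies.
   Cylinders being open and closed, no mass can be lost at their boundaries. *)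
Lemma weak_limit_exists (w : nat -> R) (x : X) (M_ : nat -> nat) :
  weight w -> (forall k, 0 < total w (M_ k)) ->
  exists (j : nat -> nat) (mu : probability X R),
    {homo j : m n / (m < n)%N} /\ limit_average w x (M_ \o j) mu.
Proof.
move=> wt tM; have [w0 _ _] := wt.
have [phi cphi sphi] := cantor_onto_shift_space R.
have /choice[code codeE] : forall i, exists b, phi b = iter i.+1 T x by move=> i; exact: sphi.
pose hit (s : seq bool) i : R := (mkseq (code i) (size s) == s)%:R.
have hit01 s i : 0 <= hit s i <= 1 by rewrite /hit; case: eqP; rewrite ?lexx ?ler01.
pose freq k s := average w (hit s) (M_ k).
have freq01 k s : 0 <= freq k s <= 1.
  apply/andP; split.
    apply: mulr_ge0; first by rewrite invr_ge0 ltW.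
    apply: sumr_ge0 => i _.
    by rewrite mulr_ge0//; have /andP[] := hit01 s i.
  apply: le_trans (ler_norm _) _; apply: norm_average_le => // i.
  by have /andP[h0 h1] := hit01 s i; rewrite ger0_norm.
have [||j [p [j_inc freq_p]]] :=
  @power_subsequence R R (seq bool : countType) `[0, 1]%classic freq.
- exact: segment_compact.
- by move=> k s; rewrite /= in_itv/=.
have p_ge0 s : 0 <= p s.
  apply: (ler_cvg_to (cvg_cst 0) (freq_p s)).
  by apply: nearW => k; have /andP[] := freq01 (j k) s.
have p_nil : p [::] = 1.
  apply: (cvg_unique _ (freq_p [::])) => //.
  rewrite (_ : (fun k => _) = fun=> 1); first exact: cvg_cst.
  apply: funext => k; rewrite /freq /average /hit.
  under eq_bigr do rewrite eqxx mulr1.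
  by rewrite mulVf// gt_eqF.
have p_split s : p s = p (rcons s false) + p (rcons s true).
  apply: (cvg_unique _ (freq_p s)) => //.
  rewrite (_ : (fun k => _) = fun k => freq (j k) (rcons s false) + freq (j k) (rcons s true)).
    exact: cvgD (freq_p _) (freq_p _).
  apply: funext => k; rewrite /freq /average -mulrDr -big_split /=; congr (_ * _).
  apply: eq_bigr => i _; rewrite -mulrDr; congr (_ * _).
  rewrite /hit !size_rcons mkseqS !eqseq_rcons.
  by case: (mkseq _ _ == s); case: (code i _); rewrite ?addr0 ?add0r.
have mq : @measurable_fun _ _ (measurableTypeR R) X setT (phi \o quantile p).
  exact: quantile_borel.
pose q := @mfun_Sub _ _ (measurableTypeR R) X (phi \o quantile p) (mem_set mq).
exists j, (distribution unif q); split=> // F cF.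
have cG : continuous (F \o phi).
  by move=> b; apply: continuous_comp; [exact: cphi|exact: cF].
have mFq : @measurable_fun _ _ (measurableTypeR R) _ setT (fun t => F (phi (quantile p t))).
  exact: (measurableT_comp (continuous_borel_real cF) mq).
have [B _ FB] := continuous_bounded cF.
have intFq : unif.-integrable setT (EFin \o (fun t => F (phi (quantile p t)))).
  apply: measurable_bounded_integrable => //.
    by rewrite (le_lt_trans (probability_le1 _ _)) ?ltry.
  by exists B; split; [exact: num_real|move=> N BN y _; exact: le_trans (FB _) (ltW BN)].
have intq : \int[distribution unif q]_y F y = \int[unif]_t F (phi (quantile p t)).
  congr fine; apply: (@integral_distribution _ _ _ _ _ unif q (EFin \o F)) => //.
  by apply/measurable_EFinP; exact: continuous_borel_real.
apply/cvgrPdist_le => e e0.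
have e3 : 0 < e / 3 by rewrite divr_gt0.
have [n Gn] := @continuous_finite_coordinates R nat id (fun=> bool) (F \o phi) (e / 3)
  cantor_space_compact cG e3.
pose c (s : seq bool) := F (phi (fun i => nth false s i)).
have cE b : `|F (phi b) - c (mkseq b n)| <= e / 3.
  by apply/ltW/Gn => i im /=; rewrite nth_mkseq.
have lim_c : (fun k => average w (fun i => c (mkseq (code i) n)) (M_ (j k))) @ \oo -->
    \sum_(s : n.-tuple bool) c s * p s.
  rewrite (_ : (fun k => _) = fun k => \sum_(s : n.-tuple bool) c s * freq (j k) s).
    by apply: cvg_finite_sum => s; apply: cvgM; [exact: cvg_cst|exact: freq_p].
  apply: funext => k; rewrite /freq -average_sum; congr (average w _ _).
  apply: funext => i; rewrite -sum_prefix; apply: eq_bigr => s _.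
  by rewrite /hit size_tuple.
have c_indic t : c (mkseq (quantile p t) n) =
    \sum_(s : n.-tuple bool) c s * \1_(cylinder p s) t.
  rewrite -sum_prefix; apply: eq_bigr => s _; congr (_ * _).
  rewrite indicE (_ : (t \in _) = (mkseq (quantile p t) n == s))//.
  by apply/idP/eqP => [/set_mem|ts]; rewrite ?inE /cylinder/= size_tuple.
have int_indic (s : seq bool) : unif.-integrable setT (EFin \o (fun t => c s * \1_(cylinder p s) t)).
  rewrite (_ : EFin \o _ = fun t => ((c s)%:E * (\1_(cylinder p s) t)%:E)%E); last first.
    by apply: funext => t; rewrite /= EFinM.
  apply: integrableZl => //; apply: integrable_indic; exact: measurable_cylinder.
have int_c : (\int[unif]_t (c (mkseq (quantile p t) n))%:E =
    (\sum_(s : n.-tuple bool) c s * p s)%:E)%E.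
  under eq_integral do rewrite c_indic -sumEFin.
  rewrite integral_sum//; last by move=> s; exact: int_indic.
  rewrite -sumEFin; apply: eq_bigr => s _.
  under eq_integral do rewrite EFinM.
  rewrite integralZl//; last first.
    by apply: integrable_indic; exact: measurable_cylinder.
  rewrite integral_indic ?setIT//; last exact: measurable_cylinder.
  by rewrite EFinM; congr (_ * _)%E; exact: uniform_cylinder.
have intc : unif.-integrable setT (EFin \o (fun t => c (mkseq (quantile p t) n))).
  rewrite (_ : EFin \o _ = fun t => (\sum_(s : n.-tuple bool) (c s * \1_(cylinder p s) t)%:E)%E).
    by apply: integrable_sum => // s _; exact: int_indic.
  by apply: funext => t; rewrite /= c_indic sumEFin.
have int_dist : `|\int[unif]_t F (phi (quantile p t)) - \sum_(s : n.-tuple bool) c s * p s| <= e / 3.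
  rewrite -[X in _ - X]/(fine (_%:E)) -int_c -RintegralB//.
  have intB : unif.-integrable setT (EFin \o
      (fun t => F (phi (quantile p t)) - c (mkseq (quantile p t) n))).
    rewrite (_ : EFin \o _ = ((EFin \o (fun t => F (phi (quantile p t)))) \-
      (EFin \o (fun t => c (mkseq (quantile p t) n))))%E); first exact: integrableB.
    by apply: funext => t.
  have int_cst (z : R) : \int[unif]_t z = z.
    rewrite Rintegral_cst// -[RHS]mulr1; congr (_ * _).
    have unif1 := congr1 fine (probability_setT unif); exact: unif1.
  rewrite ler_norml; apply/andP; split.
    rewrite -[leLHS]int_cst; apply: le_Rintegral => //.
      exact: finite_measure_integrable_cst.
    by move=> t _; have := cE (quantile p t); rewrite ler_norml => /andP[].
  rewrite -[leRHS]int_cst; apply: le_Rintegral => //.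
    exact: finite_measure_integrable_cst.
  by move=> t _; have := cE (quantile p t); rewrite ler_norml => /andP[].
have /cvgrPdist_le/(_ _ e3) near_c := lim_c.
near=> k; rewrite intq.
have avg_dist : `|average w (fun i => c (mkseq (code i) n)) (M_ (j k)) -
    average w (fun i => F (iter i.+1 T x)) (M_ (j k))| <= e / 3.
  rewrite distrC -averageB; apply: norm_average_le => // [|i]; first exact: ltW.
  by rewrite -codeE.
have c_dist : `|\sum_(s : n.-tuple bool) c s * p s -
    average w (fun i => c (mkseq (code i) n)) (M_ (j k))| <= e / 3 by near: k.
set I1 := \int[unif]_t _ in int_dist *; set I2 := \sum_(s : n.-tuple bool) _ in int_dist c_dist *.
set A1 := average w (fun i => c _) _ in avg_dist c_dist; set A2 := average w _ _ in avg_dist *.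
move: (ler_distD I2 I1 A2) (ler_distD A1 I2 A2); lra.
Unshelve. all: by end_near. Qed.

End WeakLimits.

(** * Transfer of eigenvalues between scales *)
Section Transfer.
Variable R : realType.
Local Notation X := (shift_space R).
Local Notation T := (@left_shift R).
Variables (f : nat -> unit_disc R) (x : X) (r : nat).
Hypothesis f_mul : completely_multiplicative f.
Hypothesis x_ext : extends x f.
Hypothesis r_gt0 : (0 < r)%N.
Hypothesis fr_neq0 : disc_val (f r) <> 0.

(** By domination, the preimage under [dilate] of a set that is not [mu]-null is
   not [nu]-null, which is what lifting an eigenfunction requires.  The scales are
   arbitrary so that each kind of average can choose its own. *)
Lemma spectrum_transfer (w : nat -> R) (N_ M_ : nat -> nat) (mu nu : probability X R)
    (D C alpha : R) :
  weight w -> N_ @ \oo --> \oo -> M_ @ \oo --> \oo -> 0 <= D -> 0 <= C ->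
  (forall i, w i <= D * w (r * i.+1).-1) ->
  (forall k, (r * N_ k <= M_ k)%N) ->
  (\forall k \near \oo, total w (M_ k) <= C * total w (N_ k)) ->
  limit_average w x N_ mu -> limit_average w x M_ nu ->
  spectrum mu alpha ->
  exists2 k : nat, (k < r)%N & spectrum nu ((alpha + k%:R) / r%:R).
Proof.
move=> wt Noo Moo D0 C0 wD rNM ratio limN limM.
have cS := @dilate_continuous R (disc_val (f r)) r.
apply: (spectrum_lift r_gt0 (continuous_borel cS)).
- by move=> y; exact: dilate_shift.
- exact: limit_average_invariant limN.
- exact: limit_average_invariant limM.
move=> A mA A0; apply/eqP; rewrite eq_le measure_ge0 andbT.
apply: le_trans (limit_average_transfer wt Noo cS r_gt0 D0 C0 _ wD rNM ratio limN limM mA) _.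
  by move=> F cF; exact: (dilate_asymptotic f_mul x_ext r_gt0 fr_neq0 cF).
by rewrite A0 mule0.
Qed.

Lemma divn_cvg_infty (N_ : nat -> nat) : N_ @ \oo --> \oo ->
  (fun k => N_ k %/ r)%N @ \oo --> \oo.
Proof.
move=> /cvgnyPge Noo; apply/cvgnyPge => A; near=> k.
by rewrite leq_divRL//; near: k; exact: Noo.
Unshelve. all: by end_near. Qed.

Lemma harmonic_gap N :
  total (fun i => i.+1%:R^-1 : R) N - total (fun i => i.+1%:R^-1) (N %/ r) <= r%:R.
Proof.
set m := (N %/ r)%N.
have mN : (m <= N)%N by exact: leq_div.
have Nm : (N < r * m.+1)%N by rewrite mulnC ltn_ceil.
rewrite /total (@big_cat_nat _ _ _ m 0%N N)//= addrAC subrr add0r.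
apply: (@le_trans _ _ (\sum_(m <= i < N) m.+1%:R^-1)).
  rewrite big_nat [leRHS]big_nat; apply: ler_sum => i /andP[mi _].
  by rewrite lef_pV2 ?posrE ?ltr0n// ler_nat.
rewrite sumr_const_nat -[leLHS]mulr_natl ler_pdivrMr ?ltr0n// -natrM ler_nat.
by apply: leq_trans (leq_subr _ _) (ltnW Nm).
Qed.

(** The logarithmic weight of [(N / r, N]] stays bounded, so both scales have the
   same limit. *)
Lemma log_transfer (N_ : nat -> nat) (mu : probability X R) (alpha : R) :
  N_ @ \oo --> \oo -> limit_average (fun i => i.+1%:R^-1) x N_ mu ->
  spectrum mu alpha ->
  exists2 k : nat, (k < r)%N & spectrum mu ((alpha + k%:R) / r%:R).
Proof.
move=> Noo lim.
have wt := weight_harmonic R.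
have N'oo := divn_cvg_infty Noo.
have lim' : limit_average (fun i => i.+1%:R^-1) x (fun k => N_ k %/ r)%N mu.
  move=> F cF; have [c c0 Fc] := iter_bounded x cF.
  have trunc := average_truncate_cvg0 wt Noo Fc (fun k => leq_div (N_ k) r)
    (fun k => harmonic_gap (N_ k)).
  rewrite -[X in _ --> X]add0r.
  rewrite (_ : (fun k => _) = fun k =>
    (average (fun i => i.+1%:R^-1) (fun i => F (iter i.+1 T x)) (N_ k %/ r)%N -
     average (fun i => i.+1%:R^-1) (fun i => F (iter i.+1 T x)) (N_ k)) +
    average (fun i => i.+1%:R^-1) (fun i => F (iter i.+1 T x)) (N_ k)).
    by apply: cvgD; [exact: trunc|exact: lim].
  by apply: funext => k; rewrite subrK.
apply: (@spectrum_transfer _ _ _ _ _ r%:R (1 + r%:R) alpha wt N'oo Noo) => //.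
- move=> i; rewrite prednK ?muln_gt0 ?r_gt0// natrM invfM mulrA divff ?mul1r//.
  by rewrite pnatr_eq0 -lt0n.
- by move=> k; rewrite mulnC leq_trunc_div.
- have /cvgryPge/(_ 1) := total_cvg_comp wt N'oo; apply: filterS => k t1.
  rewrite mulrDl mul1r -lerBlDl; apply: le_trans (harmonic_gap _) _.
  by rewrite ler_peMr.
Qed.

Lemma limit_average_subsequence (w : nat -> R) (N_ j : nat -> nat) (mu : probability X R) :
  j @ \oo --> \oo -> limit_average w x N_ mu -> limit_average w x (N_ \o j) mu.
Proof.
move=> joo lim F cF.
exact: (cvg_comp _ _ joo (lim F cF)).
Qed.

Lemma total_one N : total (fun=> 1 : R) N = N%:R.
Proof. by rewrite /total sumr_const_nat subn0. Qed.

(** The new system is a limit along a subsequence of [r * N_ k]. *)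
Lemma cesaro_transfer (N_ : nat -> nat) (mu : probability X R) (alpha : R) :
  {homo N_ : m n / (m < n)%N} -> (forall k, (0 < N_ k)%N) ->
  limit_average (fun=> 1) x N_ mu -> spectrum mu alpha ->
  exists2 nu : probability X R, furstenberg_system (@cesaro_avg R) x nu
    & exists2 k : nat, (k < r)%N & spectrum nu ((alpha + k%:R) / r%:R).
Proof.
move=> N_inc N_gt0 lim spec; have wt := weight_one R.
have [|j [nu [j_inc lim_nu]]] := @weak_limit_exists R _ x (fun k => r * N_ k)%N wt.
  by move=> k; rewrite total_one ltr0n muln_gt0 r_gt0 N_gt0.
have joo := increasing_cvg_infty j_inc.
have M_inc : {homo (fun k => r * N_ (j k))%N : m n / (m < n)%N}.
  by move=> m n mn; rewrite ltn_pmul2l//; apply/N_inc/j_inc.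
exists nu.
  exists (fun k => r * N_ (j k))%N; split=> //.
    by move=> k; rewrite muln_gt0 r_gt0 N_gt0.
  exact/cesaro_limit.
apply: (@spectrum_transfer (fun=> 1) (N_ \o j) (fun k => r * N_ (j k))%N mu nu 1 r%:R alpha) => //.
- by apply: increasing_cvg_infty => m n mn; apply/N_inc/j_inc.
- exact: increasing_cvg_infty.
- by move=> i; rewrite mulr1.
- by apply: nearW => k; rewrite !total_one natrM.
- exact: limit_average_subsequence.
Qed.

(** Going down instead of up: a limit [nu] at the scale [N / r] is absolutely
   continuous with respect to [mu], hence has the eigenvalue [alpha] by
   ergodicity, and [mu] is a limit at the scale [r] times larger. *)
Lemma cesaro_transfer_ergodic (N_ : nat -> nat) (mu : probability X R) (alpha : R) :
  {homo N_ : m n / (m < n)%N} ->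
  limit_average (fun=> 1) x N_ mu -> ergodic mu -> spectrum mu alpha ->
  exists2 k : nat, (k < r)%N & spectrum mu ((alpha + k%:R) / r%:R).
Proof.
move=> N_inc lim erg spec; have wt := weight_one R.
(* The shift of the index makes [L k %/ r] positive for every [k]. *)
pose L k := N_ (k + r)%N.
have L_ge k : (r <= L k)%N.
  by apply: leq_trans (increasing_ge_id N_inc (k + r)); exact: leq_addl.
have [|j [nu [j_inc lim_nu]]] := @weak_limit_exists R _ x (fun k => L k %/ r)%N wt.
  by move=> k; rewrite total_one ltr0n divn_gt0.
have Lj_inc : {homo (L \o j) : m n / (m < n)%N}.
  by move=> m n mn; apply: N_inc; rewrite ltn_add2r; exact: j_inc.
have Ljoo := increasing_cvg_infty Lj_inc.
have L'oo := divn_cvg_infty Ljoo.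
have lim_mu : limit_average (fun=> 1) x (L \o j) mu.
  apply: (@limit_average_subsequence _ N_ (fun k => j k + r)%N) lim.
  by apply: increasing_cvg_infty => m n mn; rewrite ltn_add2r; exact: j_inc.
have ratio : \forall k \near \oo, total (fun=> 1 : R) (L (j k)) <=
    2 * r%:R * total (fun=> 1 : R) (L (j k) %/ r)%N.
  apply: nearW => k; rewrite !total_one -!natrM ler_nat.
  have := ltn_ceil (L (j k)) r_gt0; have : (0 < L (j k) %/ r)%N by rewrite divn_gt0.
  nia.
have C0 : 0 <= 2 * r%:R :> R by rewrite mulr_ge0.
have nu_mu A : measurable A -> mu A = 0%E -> nu A = 0%E.
  move=> mA A0; apply/eqP; rewrite eq_le measure_ge0 andbT.
  have cid : continuous (id : X -> X) by move=> y; exact: cvg_id.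
  apply: le_trans (@limit_average_transfer R (fun=> 1) x (fun k => L (j k) %/ r)%N
    (L \o j) nu mu id 1 1 (2 * r%:R) wt L'oo cid isT ler01 C0 _ _ _ ratio lim_nu lim_mu A mA) _.
  - move=> F cF; rewrite (_ : (fun i => _) = fun=> 0); first exact: cvg_cst.
    by apply: funext => i; rewrite mul1n subrr.
  - by move=> i; rewrite mulr1.
  - by move=> k; rewrite mul1n; exact: leq_div.
  - by rewrite preimage_id A0 mule0.
have inv_mu := limit_average_invariant wt Ljoo lim_mu.
have spec_nu := ergodic_spectrum erg inv_mu nu_mu spec.
apply: (@spectrum_transfer (fun=> 1) (fun k => L (j k) %/ r)%N (L \o j) nu mu 1 (2 * r%:R) alpha) => //.
- by move=> i; rewrite mulr1.
- by move=> k; rewrite mulnC leq_trunc_div.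
Qed.

End Transfer.

Theorem theorem2p1 (R : realType) (f : nat -> unit_disc R)
    (f_mul : completely_multiplicative f)
    (x : shift_space R) (x_ext : extends x f)
    (mu : probability (shift_space R) R)
    (alpha : R) (alpha_spec : spectrum mu alpha)
    (r : nat) (r_gt0 : (0 < r)%N) (fr_neq0 : disc_val (f r) <> 0) :
  (furstenberg_system (@log_avg R) x mu ->
     exists2 k : nat, (k < r)%N & spectrum mu ((alpha + k%:R) / r%:R))
  /\
  (furstenberg_system (@cesaro_avg R) x mu ->
     (exists2 mu_r : probability (shift_space R) R,
        furstenberg_system (@cesaro_avg R) x mu_r
        & exists2 k : nat, (k < r)%N & spectrum mu_r ((alpha + k%:R) / r%:R))
     /\
     (ergodic mu ->
        exists2 k : nat, (k < r)%N & spectrum mu ((alpha + k%:R) / r%:R))).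
Proof.
split=> [[N_ [N_inc _ /log_limit lim]]|[N_ [N_inc N_gt0 /cesaro_limit lim]]].
  exact: (log_transfer f_mul x_ext r_gt0 fr_neq0 (increasing_cvg_infty N_inc) lim).
split=> [|erg]; first exact: (cesaro_transfer f_mul x_ext r_gt0 fr_neq0 N_inc N_gt0 lim).
exact: (cesaro_transfer_ergodic f_mul x_ext r_gt0 fr_neq0 N_inc lim erg).
Qed.
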